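(* Let the standing assumptions (see context) hold for $T,m,n,r,F,B,L_F,\varepsilon_r$, and assume in addition that $F\in C^2([0,T]\times\mathbb{R}^{m\times n};\mathbb{R}^{m\times n})$ with $\|\partial_t^aD_X^bF(t,X)\|\le M$ for all $t\in[0,T]$, $X\in\mathbb{R}^{m\times n}$ and all integers $a,b\ge0$ with $1\le a+b\le2$. Then there are $h_0>0$ and constants $C,C_T$, depending only on $m,n,r,B,L_F,M$ (and, for $C_T$, also on $T$), and in particular independent of the singular values of the numerical approximations, such that for all $0<h\le h_0$ and every rank-admissible computation with the projector-splitting explicit midpoint method the following holds. (i) For a step from a rank-$r$ matrix $Y_n=U_nS_nV_n^\top$ at $0\le t_n\le T-h$, with $A_n$ the solution of $\dot A_n(s)=F(t_n+s,A_n(s))$, $A_n(0)=Y_n$, $$\|Y_n+\Delta A_n-A_n(h)\|\le C(h^3+h^2\varepsilon_r),\qquad\|Y_{n+1}-A_n(h)\|\le C(h^3+h\varepsilon_r).$$ (ii) If $A(t)$ solves $\dot A(t)=F(t,A(t))$, $A(t_0)=A_0$, on $[t_0,T]$, and the computation with $t_n=t_0+nh$ starts from a rank-$r$ matrix $Y_0=U_0S_0V_0^\top$ with $\|Y_0-A(t_0)\|\le\delta$, then $$\max_{t_n\le T}\|Y_n-A(t_n)\|\le C_T(\delta+\varepsilon_r+h^2).$$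
   Context: $\|\cdot\|$ is the Frobenius norm. $D_X^bF$ is the $b$th Fréchet derivative with respect to the matrix argument, measured in the multilinear operator norm induced by the Frobenius norm. Standing assumptions: $T>0$; $m,n,r$ are integers with $1\le r<\min(m,n)$; $F:[0,T]\times\mathbb{R}^{m\times n}\to\mathbb{R}^{m\times n}$ is continuous, and there are constants $B,L_F$ such that for all $t\in[0,T]$ and $X,Z\in\mathbb{R}^{m\times n}$, $$\|F(t,X)\|\le B,\qquad\|F(t,X)-F(t,Z)\|\le L_F\|X-Z\|;$$ and for some $\varepsilon_r\ge0$, for all $t\in[0,T]$ and every rank-$r$ matrix $Y=USV^\top$ ($U\in\mathbb{R}^{m\times r}$, $V\in\mathbb{R}^{n\times r}$ with orthonormal columns, $S\in\mathbb{R}^{r\times r}$ invertible), $$\|(I-UU^\top)F(t,Y)(I-VV^\top)\|\le\varepsilon_r.$$ Reduced $K$-$L$ step, started from $(U_0,S_0,V_0)$ with increment $\Delta A\in\mathbb{R}^{m\times n}$ (where $Y_0=U_0S_0V_0^\top$, $U_0^\top U_0=V_0^\top V_0=I_r$, $S_0$ invertible): (1) set $K_1:=U_0S_0+\Delta A\,V_0=(Y_0+\Delta A)V_0$ and compute a factorization $U_1\widehat S_1=K_1$, where $U_1\in\mathbb{R}^{m\times r}$ has orthonormal columns; (2) set $L_1:=V_0S_0^\top U_0^\top U_1+\Delta A^\top U_1=(Y_0+\Delta A)^\top U_1$ and compute a factorization $V_1S_1^\top=L_1$, where $V_1\in\mathbb{R}^{n\times r}$ has orthonormal columns. The output is $Y_1:=U_1S_1V_1^\top$.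 The step is rank-admissible when $\operatorname{rank}K_1=r$ (then also $\operatorname{rank}L_1=r$, so $S_1$ is invertible). A computation with several steps or stages is rank-admissible when every reduced $K$-$L$ step in it is rank-admissible. One step of the projector-splitting explicit midpoint method from $Y_n=U_nS_nV_n^\top$ ($U_n^\top U_n=V_n^\top V_n=I_r$, $S_n$ invertible): set $F_{n,1}:=F(t_n,Y_n)$; apply the reduced $K$-$L$ step to $(U_n,S_n,V_n)$ with increment $\Delta A_{n,2}:=\frac h2F_{n,1}$, call the output $Y_{n,2}$, and set $F_{n,2}:=F(t_n+\frac h2,Y_{n,2})$; then apply the reduced $K$-$L$ step again to $(U_n,S_n,V_n)$ with increment $\Delta A_n:=hF_{n,2}$; its output is $Y_{n+1}=U_{n+1}S_{n+1}V_{n+1}^\top$. *)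

(* Defs.v *)
From mathcomp Require Import all_boot all_order all_algebra.
From mathcomp Require Import all_classical all_reals all_analysis.

Set Implicit Arguments.
Unset Strict Implicit.
Unset Printing Implicit Defensive.

Import Order.TTheory GRing.Theory Num.Theory.
Import numFieldNormedType.Exports.

Local Open Scope classical_set_scope.
Local Open Scope ring_scope.

(* The norm carried by the normedModType instance of 'M[R]_(m, n) is the
   maximum of the entries; it induces the same topology, hence the same limits
   and Frechet derivatives, but all quantitative bounds use frob. *)
Definition frob (R : realType) (m n : nat) (A : 'M[R]_(m, n)) : R :=
  Num.sqrt (\sum_(i < m) \sum_(j < n) A i j ^+ 2).

(* Extended-real valued, so that it is +oo on an unbounded L.  For b = 0 the
   only argument of L is the empty tuple. *)
Definition multilin_norm (R : realType) (m n b : nat)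
    (L : b.-tuple 'M[R]_(m, n) -> 'M[R]_(m, n)) : \bar R :=
  ereal_sup [set (frob (L Hs))%:E | Hs in
    [set Hs : b.-tuple 'M[R]_(m, n) | forall i, frob (tnth Hs i) <= 1]].

Section Calculus.
Variables (R : realType) (m n : nat).
Implicit Types (f A : R -> 'M[R]_(m, n)) (F G : R -> 'M[R]_(m, n) -> 'M[R]_(m, n)).

(* Difference quotients of f at t along s -> t with s in D and s <> t: the limit
   is the derivative, one-sided at an endpoint when D is an interval. *)
Definition quot_within (D : set R) f (t : R) : set_system 'M[R]_(m, n) :=
  (fun s => (s - t)^-1 *: (f s - f t)) @ within D t^'.

Definition partial_t (T : R) G : R -> 'M[R]_(m, n) -> 'M[R]_(m, n) :=
  fun t X => lim (quot_within `[0, T] (G ^~ X) t).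

Definition partial_X (H : 'M[R]_(m, n)) G : R -> 'M[R]_(m, n) -> 'M[R]_(m, n) :=
  fun t X => 'd (G t) X H.

(* G is C^k on [0, T] x R^(m x n): all iterated partial derivatives of order at
   most k, in any order of t and X, exist and are jointly continuous.  The maps
   X |-> D_X G(t, X) are evaluated at a fixed direction H, which in finite
   dimension is the same as differentiating them in operator norm. *)
Fixpoint class_C (k : nat) (T : R) G : Prop :=
  {within `[0, T] `*` [set: 'M[R]_(m, n)],
    continuous (fun p : R * 'M[R]_(m, n) => G p.1 p.2)} /\
  if k is k'.+1 then
    [/\ forall t X, t \in `[0, T] -> cvg (quot_within `[0, T] (G ^~ X) t),
        forall t X, t \in `[0, T] -> differentiable (G t) X,
        class_C k' T (partial_t T G)
      & forall H, class_C k' T (partial_X H G)]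
  else True.

(* The a-th time derivative of the b-linear map D_X^b F(t, X), as a map of the
   b directions. *)
Definition mixed_partial (T : R) F (a b : nat) (t : R) (X : 'M[R]_(m, n))
    (Hs : b.-tuple 'M[R]_(m, n)) : 'M[R]_(m, n) :=
  iter a (partial_t T) (foldr partial_X F Hs) t X.

(* A' (s) = G (s, A s) on [a, b] with A a = A0. *)
Definition ode_solution G (a b : R) (A0 : 'M[R]_(m, n)) A : Prop :=
  A a = A0 /\
  forall s, s \in `[a, b] -> quot_within `[a, b] A s --> G s (A s).

End Calculus.

Record factors (R : realType) (m n r : nat) := Factors {
  facU : 'M[R]_(m, r);
  facS : 'M[R]_r;
  facV : 'M[R]_(n, r) }.

Section ProjectorSplitting.
Variables (R : realType) (m n r : nat).
Implicit Types (Y : factors R m n r) (dA : 'M[R]_(m, n)).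
Implicit Type F : R -> 'M[R]_(m, n) -> 'M[R]_(m, n).

Definition orthonormal_cols (p : nat) (Q : 'M[R]_(p, r)) : Prop :=
  Q^T *m Q = 1%:M.

Definition fac_mx Y : 'M[R]_(m, n) := facU Y *m facS Y *m (facV Y)^T.

Definition rank_r_factors Y : Prop :=
  [/\ orthonormal_cols (facU Y), orthonormal_cols (facV Y)
    & facS Y \in unitmx].

Definition tangent_bound (T : R) F (eps : R) : Prop :=
  forall t Y, t \in `[0, T] -> rank_r_factors Y ->
    frob ((1%:M - facU Y *m (facU Y)^T) *m F t (fac_mx Y)
            *m (1%:M - facV Y *m (facV Y)^T)) <= eps.

Definition K_mx Y dA : 'M[R]_(m, r) := facU Y *m facS Y + dA *m facV Y.

Definition L_mx Y dA (U1 : 'M[R]_(m, r)) : 'M[R]_(n, r) :=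
  facV Y *m (facS Y)^T *m (facU Y)^T *m U1 + dA^T *m U1.

(* A relation, since the two orthonormal factorizations are not unique. *)
Definition KL_step Y0 dA Y1 : Prop :=
  [/\ orthonormal_cols (facU Y1),
      exists Shat : 'M[R]_r, facU Y1 *m Shat = K_mx Y0 dA,
      orthonormal_cols (facV Y1)
    & facV Y1 *m (facS Y1)^T = L_mx Y0 dA (facU Y1)].

Definition KL_admissible Y0 dA : Prop := \rank (K_mx Y0 dA) = r.

(* Increments of the two stages of a midpoint step at time t; Ymid is the
   output of the first stage. *)
Definition stage_incr F (h t : R) Y : 'M[R]_(m, n) :=
  (h / 2) *: F t (fac_mx Y).

Definition midpoint_incr F (h t : R) (Ymid : factors R m n r) : 'M[R]_(m, n) :=
  h *: F (t + h / 2) (fac_mx Ymid).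

Definition midpoint_step F (h t : R) Y Ymid Ynext : Prop :=
  KL_step Y (stage_incr F h t Y) Ymid /\
  KL_step Y (midpoint_incr F h t Ymid) Ynext.

Definition midpoint_admissible F (h t : R) Y Ymid : Prop :=
  KL_admissible Y (stage_incr F h t Y) /\
  KL_admissible Y (midpoint_incr F h t Ymid).

End ProjectorSplitting.

(* Main.v *)
Require Import Defs.
From mathcomp Require Import all_boot all_order all_algebra.
From mathcomp Require Import all_classical all_reals all_analysis.
From mathcomp Require Import ring lra.
Import Order.TTheory GRing.Theory Num.Theory.
Import numFieldNormedType.Exports.
Local Open Scope classical_set_scope.
Local Open Scope ring_scope.

Set Implicit Arguments.
Unset Strict Implicit.
Unset Printing Implicit Defensive.

(** Let Y0 be a rank-r matrix with right factor V0 and let A = Y0 + dA.  The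
   reduced K-L step returns U1 U1^T A, where the range of U1 contains that of
   A V0, so its error is P A with P = 1 - U1 U1^T and P A V0 = 0.  If some X of
   rank at most r is close to A and its row space is close to that of V0, then
   P X is controlled by its part P X V0 V0^T = P (X - A) V0 V0^T, and the error is
   at most 3 |A - X| ([KL_step_quasi_optimal]).  It remains to find X without
   dividing by singular values.

   The row space of a rank-r matrix U S V^T moving with the field rotates like
   S^-1 U^T F (1 - V V^T).  This stays bounded for small singular values because F
   is Lipschitz: when the component of Y along a left direction x is deleted, x can
   be made a normal direction, so |x^T U^T F (1 - V V^T)| <= eps |x| + L |x^T S|
   ([nearly_tangent_dir]).  Hence U^T F (1 - V V^T) = S D + O(eps) with D bounded in
   terms of L and n only ([regularized_factor]), and an Euler step of length tau can
   be followed on matrices of rank at most r with error O(tau (eps + tau)), the row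
   space turning by O(tau) ([projected_euler_step]).  Composing N such steps with
   tau = h / N <= h^2 gives an X within O(h eps + h^3) of the flow whose row space
   is within O(h) of that of V0 ([rank_r_flow]).

   The classical part compares everything with the quadratic Taylor polynomial p of
   the solution.  It satisfies the equation up to a second-order defect, so the
   polygon of projected Euler steps, the exact solution sampled at the same times
   and the explicit midpoint map are all close to p at time h
   ([quadratic_approximation], [perturbed_euler], [solution_midpoint_error]).  The
   first stage of the method has error O(h eps + h^2), which the factor h in the
   second increment turns into O(h^2 eps + h^3) ([midpoint_step_error]).  Since the
   midpoint map is Lipschitz with constant 1 + O(h), the discrete Gronwall
   inequality sums the local errors ([global_error]). *)

(** * The Frobenius norm *)

Section Frobenius.
Variable R : realType.

(** The trace form turns inner-product computations into matrix algebra. *)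
Definition fdot m n (A B : 'M[R]_(m, n)) : R := \tr (A^T *m B).

Lemma fdotE m n (A B : 'M[R]_(m, n)) :
  fdot A B = \sum_(i < m) \sum_(j < n) A i j * B i j.
Proof.
rewrite /fdot /mxtrace exchange_big /=; apply: eq_bigr => j _.
by rewrite mxE; apply: eq_bigr => i _; rewrite mxE.
Qed.

Lemma fdotC m n (A B : 'M[R]_(m, n)) : fdot A B = fdot B A.
Proof. by rewrite /fdot -mxtrace_tr trmx_mul trmxK. Qed.

Lemma fdotDl m n (A B C : 'M[R]_(m, n)) : fdot (A + B) C = fdot A C + fdot B C.
Proof. by rewrite /fdot linearD mulmxDl mxtraceD. Qed.

Lemma fdotZl m n a (A B : 'M[R]_(m, n)) : fdot (a *: A) B = a * fdot A B.
Proof. by rewrite /fdot linearZ -scalemxAl mxtraceZ. Qed.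

Lemma fdotDr m n (A B C : 'M[R]_(m, n)) : fdot A (B + C) = fdot A B + fdot A C.
Proof. by rewrite fdotC fdotDl !(fdotC A). Qed.

Lemma fdotZr m n a (A B : 'M[R]_(m, n)) : fdot A (a *: B) = a * fdot A B.
Proof. by rewrite fdotC fdotZl fdotC. Qed.

Lemma fdotNr m n (A B : 'M[R]_(m, n)) : fdot A (- B) = - fdot A B.
Proof. by rewrite -scaleN1r fdotZr mulN1r. Qed.

Lemma fdotNl m n (A B : 'M[R]_(m, n)) : fdot (- A) B = - fdot A B.
Proof. by rewrite fdotC fdotNr fdotC. Qed.

Lemma fdot_mull m n p (P : 'M[R]_(p, m)) (A : 'M[R]_(m, n)) B :
  fdot (P *m A) B = fdot A (P^T *m B).
Proof. by rewrite /fdot trmx_mul mulmxA. Qed.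

Lemma fdot_ge0 m n (A : 'M[R]_(m, n)) : 0 <= fdot A A.
Proof.
by rewrite fdotE; apply: sumr_ge0 => i _; apply: sumr_ge0 => j _; rewrite -expr2 sqr_ge0.
Qed.

Lemma frobE m n (A : 'M[R]_(m, n)) : frob A = Num.sqrt (fdot A A).
Proof.
by rewrite /frob fdotE; congr Num.sqrt; apply: eq_bigr => i _; apply: eq_bigr.
Qed.

Lemma frob_sqr m n (A : 'M[R]_(m, n)) : frob A ^+ 2 = fdot A A.
Proof. by rewrite frobE sqr_sqrtr // fdot_ge0. Qed.

Lemma frob_ge0 m n (A : 'M[R]_(m, n)) : 0 <= frob A.
Proof. exact: sqrtr_ge0. Qed.

Lemma frob_le m n (A : 'M[R]_(m, n)) c : 0 <= c -> fdot A A <= c ^+ 2 -> frob A <= c.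
Proof. by move=> c0 h; rewrite frobE -(ger0_norm c0) -sqrtr_sqr ler_wsqrtr. Qed.

Lemma fdot_eq0 m n (A : 'M[R]_(m, n)) : fdot A A = 0 -> A = 0.
Proof.
rewrite fdotE => /eqP; rewrite psumr_eq0 => [/allP h|i _]; last first.
  by apply: sumr_ge0 => j _; rewrite -expr2 sqr_ge0.
apply/matrixP => i j; rewrite mxE.
have := h i (mem_index_enum _); rewrite psumr_eq0 => [/allP/(_ j (mem_index_enum _))|k _].
  by rewrite -expr2 sqrf_eq0 => /eqP.
by rewrite -expr2 sqr_ge0.
Qed.

Lemma frob_eq0 m n (A : 'M[R]_(m, n)) : frob A = 0 -> A = 0.
Proof. by move=> h; apply: fdot_eq0; rewrite -frob_sqr h expr0n. Qed.

Lemma frobZ m n a (A : 'M[R]_(m, n)) : frob (a *: A) = `|a| * frob A.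
Proof.
by rewrite !frobE fdotZl fdotZr mulrA -expr2 sqrtrM ?sqr_ge0 // sqrtr_sqr.
Qed.

Lemma frob0 m n : frob (0 : 'M[R]_(m, n)) = 0.
Proof. by rewrite -(scale0r (0 : 'M[R]_(m, n))) frobZ normr0 mul0r. Qed.

Lemma frobN m n (A : 'M[R]_(m, n)) : frob (- A) = frob A.
Proof. by rewrite -scaleN1r frobZ normrN1 mul1r. Qed.

Lemma frobC m n (A B : 'M[R]_(m, n)) : frob (A - B) = frob (B - A).
Proof. by rewrite -frobN opprB. Qed.

Lemma frob_tr m n (A : 'M[R]_(m, n)) : frob A^T = frob A.
Proof. by rewrite !frobE /fdot trmxK mxtrace_mulC. Qed.

(** The square of b A - a B is nonnegative, with a and b the norms of A and B. *)
Lemma cauchy_schwarz m n (A B : 'M[R]_(m, n)) : fdot A B <= frob A * frob B.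
Proof.
have a0 := frob_ge0 A; have b0 := frob_ge0 B.
have [/frob_eq0 ->|aN0] := eqVneq (frob A) 0.
  by rewrite frob0 mul0r /fdot trmx0 mul0mx mxtrace0.
have [/frob_eq0 ->|bN0] := eqVneq (frob B) 0.
  by rewrite frob0 mulr0 /fdot mulmx0 mxtrace0.
have ab0 : 0 < frob A * frob B by rewrite mulr_gt0 // lt_def ?aN0 ?bN0.
have := fdot_ge0 (frob B *: A - frob A *: B).
rewrite fdotDl !fdotDr !fdotNl !fdotNr !fdotZl !fdotZr -!frob_sqr (fdotC B A) => h.
by rewrite -(ler_pM2l ab0); nra.
Qed.

Lemma frobD m n (A B : 'M[R]_(m, n)) : frob (A + B) <= frob A + frob B.
Proof.
have := cauchy_schwarz A B; have a0 := frob_ge0 A; have b0 := frob_ge0 B => cs.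
apply: frob_le; first exact: addr_ge0.
by rewrite !(fdotDl, fdotDr) (fdotC B A) -!frob_sqr; nra.
Qed.

Lemma frobB m n (A B : 'M[R]_(m, n)) : frob (A - B) <= frob A + frob B.
Proof. by rewrite -(frobN B) frobD. Qed.

Lemma frob_tri m n (B A C : 'M[R]_(m, n)) : frob (A - C) <= frob (A - B) + frob (B - C).
Proof. by rewrite -[A - C](subrKA B) frobD. Qed.

Lemma frob_sum m n (I : Type) (s : seq I) (P : pred I) (A : I -> 'M[R]_(m, n)) :
  frob (\sum_(i <- s | P i) A i) <= \sum_(i <- s | P i) frob (A i).
Proof.
elim/big_rec2: _ => [|i x B _ h]; first by rewrite frob0.
by apply: le_trans (frobD _ _) _; rewrite lerD2l.
Qed.

Lemma frobM m n p (A : 'M[R]_(m, n)) (B : 'M[R]_(n, p)) : frob (A *m B) <= frob A * frob B.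
Proof.
apply: frob_le; first by rewrite mulr_ge0 // frob_ge0.
rewrite exprMn !frob_sqr.
have -> : fdot B B = \sum_(j < p) fdot (col j B) (col j B).
  rewrite fdotE exchange_big; apply: eq_bigr => j _; rewrite fdotE; apply: eq_bigr => i _.
  by rewrite big_ord1 !mxE.
have -> : fdot A A = \sum_(i < m) fdot (row i A)^T (row i A)^T.
  rewrite fdotE; apply: eq_bigr => i _; rewrite fdotE; apply: eq_bigr => j _.
  by rewrite big_ord1 !mxE.
rewrite fdotE mulr_suml; apply: ler_sum => i _; rewrite mulr_sumr; apply: ler_sum => j _.
have -> : (A *m B) i j = fdot (row i A)^T (col j B).
  by rewrite mxE fdotE; apply: eq_bigr => k _; rewrite big_ord1 !mxE.
set x := (row i A)^T; set y := col j B.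
have h1 := cauchy_schwarz x y; have := cauchy_schwarz (- x) y.
rewrite fdotNl frobN => h2.
have ab0 : 0 <= frob x * frob y by rewrite mulr_ge0 ?frob_ge0.
by rewrite -!frob_sqr -exprMn -expr2; nra.
Qed.

Lemma entry_le_frob m n (A : 'M[R]_(m, n)) i j : `|A i j| <= frob A.
Proof.
rewrite -(@ler_pXn2r _ 2) ?nnegrE ?frob_ge0 // frob_sqr fdotE (bigD1 i) //= (bigD1 j) //=.
rewrite real_normK ?num_real // -expr2 -addrA lerDl addr_ge0 //.
  by apply: sumr_ge0 => k _; rewrite -expr2 sqr_ge0.
by apply: sumr_ge0 => k _; apply: sumr_ge0 => l _; rewrite -expr2 sqr_ge0.
Qed.

Lemma frob_delta m n i j : frob (delta_mx i j : 'M[R]_(m, n)) <= 1.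
Proof.
apply: frob_le => //; rewrite fdotE (bigD1 i) //= (bigD1 j) //= !mxE !eqxx mulr1.
rewrite !big1 ?addr0 ?expr1n // => k; last by move=> kj; rewrite mxE (negbTE kj) andbF mulr0.
by move=> ki; rewrite big1 // => l _; rewrite mxE (negbTE ki) mulr0.
Qed.

Lemma frob_entries m n (A : 'M[R]_(m, n)) c : 0 <= c ->
  (forall i j, `|A i j| <= c) -> frob A <= (m * n)%:R * c.
Proof.
move=> c0 hA; rewrite (matrix_sum_delta A); apply: le_trans (frob_sum _ _ _) _.
have -> : (m * n)%:R * c = \sum_(i < m) n%:R * c.
  by rewrite sumr_const card_ord natrM -mulrA mulr_natl.
apply: ler_sum => i _; apply: le_trans (frob_sum _ _ _) _.
have -> : n%:R * c = \sum_(j < n) c by rewrite sumr_const card_ord mulr_natl.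
apply: ler_sum => j _; rewrite frobZ; apply: le_trans (hA i j).
by rewrite ler_piMr // frob_delta.
Qed.

Lemma frob_cols m n (A : 'M[R]_(m, n)) c :
  (forall j, frob (col j A) <= c) -> frob A <= n%:R * c.
Proof.
move=> hA; have -> : A = \sum_j col j A *m delta_mx (0 : 'I_1) j.
  apply/matrixP => i k; rewrite summxE (bigD1 k) //= big1 ?addr0 => [|j jk].
    by rewrite !mxE big_ord1 !mxE !eqxx mulr1.
  by rewrite !mxE big_ord1 !mxE (eq_sym k) (negbTE jk) andbF mulr0.
apply: le_trans (frob_sum _ _ _) _.
have -> : n%:R * c = \sum_(j < n) c by rewrite sumr_const card_ord mulr_natl.
apply: ler_sum => j _; apply: le_trans (hA j); apply: le_trans (frobM _ _) _.
by rewrite ler_piMr ?frob_delta ?frob_ge0.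
Qed.

(** * Orthonormal columns and the projections they define *)

Lemma frob_orth m n p (U : 'M[R]_(m, n)) (A : 'M[R]_(n, p)) :
  orthonormal_cols U -> frob (U *m A) = frob A.
Proof. by move=> hU; rewrite !frobE fdot_mull mulmxA hU mul1mx. Qed.

Lemma frob_orthT m n p (V : 'M[R]_(m, n)) (A : 'M[R]_(p, n)) :
  orthonormal_cols V -> frob (A *m V^T) = frob A.
Proof. by move=> hV; rewrite -frob_tr trmx_mul trmxK frob_orth // frob_tr. Qed.

(** By Pythagoras: (1 - P) A and P A are orthogonal. *)
Lemma frob_proj m n p (U : 'M[R]_(m, n)) (A : 'M[R]_(m, p)) : orthonormal_cols U ->
  frob ((1%:M - U *m U^T) *m A) <= frob A /\ frob (U *m U^T *m A) <= frob A.
Proof.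
move=> hU; have o : fdot ((1%:M - U *m U^T) *m A) (U *m U^T *m A) = 0.
  rewrite fdot_mull linearB /= trmx1 trmx_mul trmxK mulmxA mulmxBl mul1mx.
  by rewrite mulmxA -(mulmxA U) hU mulmx1 subrr mul0mx /fdot mulmx0 mxtrace0.
have : fdot A A = fdot ((1%:M - U *m U^T) *m A) ((1%:M - U *m U^T) *m A) +
    fdot (U *m U^T *m A) (U *m U^T *m A).
  have {1 2}-> : A = (1%:M - U *m U^T) *m A + U *m U^T *m A.
    by rewrite mulmxBl mul1mx subrK.
  by rewrite fdotDl !fdotDr [fdot (U *m U^T *m A) ((1%:M - _) *m A)]fdotC o addr0 add0r.
move=> e; split; apply: frob_le; rewrite ?frob_ge0 // frob_sqr e ?lerDl ?lerDr fdot_ge0 //.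
Qed.

Lemma frob_projl m n p (U : 'M[R]_(m, n)) (A : 'M[R]_(m, p)) : orthonormal_cols U ->
  frob ((1%:M - U *m U^T) *m A) <= frob A.
Proof. by move=> hU; case: (frob_proj A hU). Qed.

Lemma frob_projr m n p (V : 'M[R]_(m, n)) (A : 'M[R]_(p, m)) : orthonormal_cols V ->
  frob (A *m (1%:M - V *m V^T)) <= frob A.
Proof.
by move=> hV; rewrite -frob_tr trmx_mul linearB /= trmx1 trmx_mul trmxK -(frob_tr A) frob_projl.
Qed.

Lemma trmxZ m n a (A : 'M[R]_(m, n)) : (a *: A)^T = a *: A^T.
Proof. by apply/matrixP => i j; rewrite !mxE. Qed.

Lemma exists_orth_vec m r (Q : 'M[R]_(m, r)) : (r < m)%N ->
  exists u : 'cV[R]_m, u^T *m u = 1%:M /\ Q^T *m u = 0.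
Proof.
move=> rm; have : kermx Q != 0.
  by rewrite -mxrank_eq0 mxrank_ker -lt0n subn_gt0 (leq_ltn_trans (rank_leq_col Q)).
move/rowV0Pn => [v /sub_kermxP vQ vN0].
have fv0 : frob v != 0 by apply: contra_neq vN0 => /frob_eq0.
exists ((frob v)^-1 *: v^T); split; last first.
  by rewrite -scalemxAr -trmx_mul vQ trmx0 scaler0.
rewrite trmxZ trmxK -scalemxAl -scalemxAr scalerA.
have -> : v *m v^T = (frob v ^+ 2)%:M.
  by rewrite frob_sqr /fdot mxtrace_mulC {1}[v *m v^T]mx11_scalar -trace_mx11.
by rewrite scale_scalar_mx -invfM -expr2 mulVf // sqrf_eq0.
Qed.

(** Gram-Schmidt on the columns; a column that depends on its predecessors
   is given a new direction, which exists since there are at most m columns. *)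
Lemma qr_factor m r (K : 'M[R]_(m, r)) : (r <= m)%N ->
  exists (Q : 'M[R]_(m, r)) (T : 'M[R]_r), orthonormal_cols Q /\ K = Q *m T.
Proof.
elim: r K => [|r IH] K rm.
  by exists 0, 0; split; [apply/matrixP => - [] | apply/matrixP => i []].
move: K; rewrite -addn1 => K.
have [Q [T [hQ hK]]] := IH (lsubmx K) (ltnW rm).
set k := rsubmx K; pose v := k - Q *m (Q^T *m k).
have Qv : Q^T *m v = 0 by rewrite /v mulmxBr (mulmxA Q^T Q) hQ mul1mx subrr.
have [u [c [uu Qu vE]]] : exists (u : 'cV[R]_m) (c : R), [/\ u^T *m u = 1%:M, Q^T *m u = 0 & v = c *: u].
  have [v0|vN0] := eqVneq (frob v) 0.
    have [u [uu Qu]] := exists_orth_vec Q rm.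
    by exists u, 0; rewrite scale0r; split=> //; apply: frob_eq0.
  exists ((frob v)^-1 *: v), (frob v); split.
  - rewrite trmxZ -scalemxAl -scalemxAr scalerA.
    rewrite (mx11_scalar (_ *m _)) -trace_mx11 -/(fdot v v) -frob_sqr.
    by rewrite scale_scalar_mx -invfM -expr2 mulVf // sqrf_eq0.
  - by rewrite -scalemxAr Qv scaler0.
  - by rewrite scalerA divff // scale1r.
have uQ : u^T *m Q = 0 by rewrite -[LHS]trmxK trmx_mul trmxK Qu trmx0.
exists (row_mx Q u), (block_mx T (Q^T *m k) 0 c%:M); split.
  by rewrite /orthonormal_cols tr_row_mx mul_col_row hQ Qu uQ uu -scalar_mx_block.
rewrite mul_row_block mulmx0 addr0 -hK.
have -> : Q *m (Q^T *m k) + u *m c%:M = k by rewrite mul_mx_scalar -vE addrC subrK.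
by rewrite hsubmxK.
Qed.

(** For two projections P and Q of the same rank, hence of the same trace, the
   squares of both norms are multiples of \tr Q - \tr (P Q). *)
Lemma proj_dist n r (V W : 'M[R]_(n, r)) : orthonormal_cols V -> orthonormal_cols W ->
  frob (W *m W^T - V *m V^T) <= 2 * frob (V *m V^T *m (1%:M - W *m W^T)).
Proof.
move=> hV hW; set P := V *m V^T; set Q := W *m W^T.
have PP : P *m P = P by rewrite /P mulmxA -(mulmxA V) hV mulmx1.
have QQ : Q *m Q = Q by rewrite /Q mulmxA -(mulmxA W) hW mulmx1.
have Pt : P^T = P by rewrite trmx_mul trmxK.
have Qt : Q^T = Q by rewrite trmx_mul trmxK.
have trPQ : \tr P = \tr Q by rewrite /P mxtrace_mulC hV /Q mxtrace_mulC hW.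
have e1 : fdot (Q - P) (Q - P) = 2 * (\tr Q - \tr (P *m Q)).
  have -> : fdot (Q - P) (Q - P) = \tr ((Q - P) *m (Q - P)).
    by rewrite /fdot [(Q - P)^T]raddfB /= Pt Qt.
  rewrite mulmxBl !mulmxBr QQ PP !(raddfB mxtrace) /= trPQ.
  rewrite (mxtrace_mulC Q P); ring.
have e2 : fdot (P *m (1%:M - Q)) (P *m (1%:M - Q)) = \tr Q - \tr (P *m Q).
  rewrite fdot_mull Pt mulmxA PP /fdot [(1%:M - Q)^T]raddfB /= trmx1 Qt mulmxBr mulmx1.
  rewrite mulmxBl mul1mx mulmxBr !(raddfB mxtrace) /= trPQ mulmxA.
  rewrite (mxtrace_mulC (Q *m P)) (mulmxA Q Q) QQ (mxtrace_mulC Q P); ring.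
apply: frob_le; first by rewrite mulr_ge0 // frob_ge0.
by rewrite exprMn frob_sqr e1 e2 -e2; have := fdot_ge0 (P *m (1%:M - Q)); nra.
Qed.

End Frobenius.

(** * Nearly tangent fields on matrices of rank at most r *)

Section Tangency.
Variable R : realType.

Definition orth_factors m n r (Y : factors R m n r) : Prop :=
  orthonormal_cols (facU Y) /\ orthonormal_cols (facV Y).

Definition nearly_tangent m n r (G : 'M[R]_(m, n) -> 'M[R]_(m, n)) (eps : R) : Prop :=
  forall Y : factors R m n r, rank_r_factors Y ->
    frob ((1%:M - facU Y *m (facU Y)^T) *m G (fac_mx Y)
            *m (1%:M - facV Y *m (facV Y)^T)) <= eps.

Definition lipschitz_frob m n (G : 'M[R]_(m, n) -> 'M[R]_(m, n)) (L : R) : Prop :=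
  forall X Z, frob (G X - G Z) <= L * frob (X - Z).

Lemma unit_perturbation r (S : 'M[R]_r) :
  exists C : 'M[R]_r, forall s, s != 0 -> S + s *: C \in unitmx.
Proof.
exists (col_ebase S *m copid_mx (\rank S) *m row_ebase S) => s s0.
have -> : S + s *: (col_ebase S *m copid_mx (\rank S) *m row_ebase S) =
    col_ebase S *m (pid_mx (\rank S) + s *: copid_mx (\rank S)) *m row_ebase S.
  move: (copid_mx _) => c; by rewrite mulmxDr mulmxDl mulmx_ebase -scalemxAr -scalemxAl.
rewrite !unitmx_mul col_ebase_unit row_ebase_unit andbT /=.
have rS : (\rank S <= r)%N := rank_leq_row S.
suff : (pid_mx (\rank S) + s *: copid_mx (\rank S)) *m
    (pid_mx (\rank S) + s^-1 *: copid_mx (\rank S)) = 1%:M :> 'M[R]_r.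
  by case/mulmx1_unit.
rewrite mulmxDr !mulmxDl -!scalemxAl -!scalemxAr scalerA.
rewrite pid_mx_id // mul_pid_mx_copid // mul_copid_mx_pid // copid_mx_id //.
rewrite !scaler0 addr0 add0r mulfV // scale1r.
by rewrite /copid_mx addrC subrK.
Qed.

(** The tangency bound extends to singular cores: invertible cores are dense and
   the field is continuous.  Projected steps may lose rank, so this extension is
   what allows them to be iterated. *)
Lemma nearly_tangent_singular m n r (G : 'M[R]_(m, n) -> 'M[R]_(m, n)) eps L
    (Y : factors R m n r) :
  nearly_tangent r G eps -> lipschitz_frob G L -> 0 <= L -> orth_factors Y ->
  frob ((1%:M - facU Y *m (facU Y)^T) *m G (fac_mx Y)
          *m (1%:M - facV Y *m (facV Y)^T)) <= eps.
Proof.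
case: Y => U S V hG hL L0 [/= hU hV].
have [C hC] := unit_perturbation S.
(* Perturbing the core by s C changes the field by at most s c; the term 1 only
   makes c positive. *)
pose c := L * frob C + 1.
have c0 : 0 < c by rewrite ltr_wpDl // mulr_ge0 ?frob_ge0.
apply/ler_addgt0Pr => d d0; pose s := d / c.
have s0 : 0 < s by rewrite divr_gt0.
pose Ys := Factors U (S + s *: C) V.
have := hG Ys; rewrite /rank_r_factors /= hC ?gt_eqF // => /(_ (And3 hU hV isT)) hYs.
set P := 1%:M - U *m U^T; set Q := 1%:M - V *m V^T.
have -> : P *m G (fac_mx (Factors U S V)) *m Q =
    P *m G (fac_mx Ys) *m Q + P *m (G (fac_mx (Factors U S V)) - G (fac_mx Ys)) *m Q.
  by rewrite -mulmxDl -mulmxDr addrC subrK.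
apply: le_trans (frobD _ _) _; apply: lerD => //.
apply: le_trans (frob_projr _ hV) _; apply: le_trans (frob_projl _ hU) _.
apply: le_trans (hL _ _) _; rewrite /fac_mx /= -mulmxBl -mulmxBr opprD addNKr.
rewrite frob_orthT // frob_orth // frobN frobZ gtr0_norm //.
have -> : d = s * c by rewrite /s divfK // gt_eqF.
rewrite mulrCA ler_wpM2l ?(ltW s0) // /c; lra.
Qed.

(** Deleting the direction y from the core moves Y by frob (y^T S).  Since r < m,
   the freed column of U can then be replaced by a vector orthogonal to U, and
   U y becomes a normal direction, in which the field is at most eps.  So the
   field nearly respects the row space of Y in the directions of the small
   singular values. *)
Lemma nearly_tangent_unit_dir m n r (G : 'M[R]_(m, n) -> 'M[R]_(m, n)) eps L
    (Y : factors R m n r) (y : 'cV[R]_r) : (r < m)%N ->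
  nearly_tangent r G eps -> lipschitz_frob G L -> 0 <= L -> orth_factors Y ->
  y^T *m y = 1%:M ->
  frob (y^T *m ((facU Y)^T *m G (fac_mx Y) *m (1%:M - facV Y *m (facV Y)^T)))
    <= eps + L * frob (y^T *m facS Y).
Proof.
case: Y => U S V rm hG hL L0 [/= hU hV] yy.
have [u [uu Uu]] := exists_orth_vec U rm.
have uU : u^T *m U = 0 by rewrite -[LHS]trmxK trmx_mul trmxK Uu trmx0.
pose p : 'M[R]_r := 1%:M - y *m y^T.
have pt : p^T = p by rewrite /p raddfB /= trmx1 trmx_mul trmxK.
have yp : y^T *m p = 0 by rewrite /p mulmxBr mulmx1 mulmxA yy mul1mx subrr.
have pp : p *m p = p by rewrite {1}/p mulmxBl mul1mx -mulmxA yp mulmx0 subr0.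
(* The column space of U' is that of U with the direction U y replaced by u. *)
pose U' := U *m p + u *m y^T.
have U't : U'^T = p *m U^T + y *m u^T by rewrite /U' raddfD /= !trmx_mul trmxK pt.
have pE : p + y *m y^T = 1%:M by rewrite /p subrK.
clearbody p; have UU' : U^T *m U' = p.
  by rewrite /U' (mulmxDr U^T) !mulmxA hU mul1mx Uu mul0mx addr0.
have uU' : u^T *m U' = y^T.
  by rewrite /U' (mulmxDr u^T) !mulmxA uU mul0mx add0r uu mul1mx.
have hU' : orthonormal_cols U'.
  by rewrite /orthonormal_cols U't mulmxDl -!mulmxA UU' uU' pp.
pose Y' := Factors U' (p *m S) V.
have Y'E : fac_mx Y' = U *m (p *m S) *m V^T.
  rewrite /fac_mx /= /U' mulmxDl -(mulmxA U p) (mulmxA p p) pp.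
  by rewrite -(mulmxA u) (mulmxA y^T) yp mul0mx mulmx0 addr0.
have ty : frob y^T = 1.
  by rewrite frobE /fdot mxtrace_mulC trmxK yy mxtrace1 sqrtr1.
have tyU : frob (y^T *m U^T) = 1 by rewrite frob_orthT.
have yU' : y^T *m U^T *m U' = 0 by rewrite -mulmxA UU' yp.
have := @nearly_tangent_singular m n r G eps L Y' hG hL L0 (conj hU' hV).
rewrite /= => h'.
set g := G _; set Q := 1%:M - V *m V^T.
have -> : y^T *m (U^T *m g *m Q) = y^T *m U^T *m ((1%:M - U' *m U'^T) *m G (fac_mx Y') *m Q)
     + y^T *m U^T *m ((g - G (fac_mx Y')) *m Q).
  rewrite !mulmxA.
  have -> : y^T *m U^T *m (1%:M - U' *m U'^T) = y^T *m U^T.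
    by rewrite mulmxBr mulmx1 mulmxA yU' mul0mx subr0.
  by rewrite -mulmxDl -(mulmxDr (y^T *m U^T)) addrC subrK.
apply: le_trans (frobD _ _) _; apply: lerD.
  by apply: le_trans (frobM _ _) _; rewrite tyU mul1r.
apply: le_trans (frobM _ _) _; rewrite tyU mul1r.
apply: le_trans (frob_projr _ hV) _; apply: le_trans (hL _ _) _.
rewrite ler_wpM2l // Y'E /fac_mx /= -mulmxBl -(mulmxBr U) (frob_orthT _ hV) (frob_orth _ hU).
have -> : S - p *m S = y *m (y^T *m S) by rewrite mulmxA -{1}[S]mul1mx -pE mulmxDl addrAC subrr add0r.
by apply: le_trans (frobM _ _) _; rewrite -frob_tr ty mul1r.
Qed.

Lemma nearly_tangent_dir m n r (G : 'M[R]_(m, n) -> 'M[R]_(m, n)) eps L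
    (Y : factors R m n r) (x : 'cV[R]_r) : (r < m)%N ->
  nearly_tangent r G eps -> lipschitz_frob G L -> 0 <= L -> orth_factors Y ->
  frob (x^T *m ((facU Y)^T *m G (fac_mx Y) *m (1%:M - facV Y *m (facV Y)^T)))
    <= eps * frob x + L * frob (x^T *m facS Y).
Proof.
move=> rm hG hL L0 hY.
have [/frob_eq0 ->|xN0] := eqVneq (frob x) 0.
  by rewrite trmx0 !mul0mx !frob0 !mulr0 addr0.
have x0 : 0 < frob x by rewrite lt_def xN0 frob_ge0.
pose y := (frob x)^-1 *: x.
have xE : x = frob x *: y by rewrite /y scalerA divff // scale1r.
have yy : y^T *m y = 1%:M.
  rewrite /y trmxZ -scalemxAl -scalemxAr scalerA.
  rewrite (mx11_scalar (_ *m _)) -trace_mx11 -/(fdot x x) -frob_sqr.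
  by rewrite scale_scalar_mx -invfM -expr2 mulVf // sqrf_eq0.
have := nearly_tangent_unit_dir rm hG hL L0 hY yy => h.
rewrite [in x^T]xE trmxZ -!scalemxAl !frobZ (gtr0_norm x0).
rewrite mulrCA (mulrC eps) -mulrDr ler_wpM2l //; exact: ltW.
Qed.

(** The row bound says that N N^T is dominated by e^2 + l^2 S S^T up to a
   factor, so N nearly factors through S.  D is the regularized least squares
   solution l^2 S^T H^-1 N with H = e^2 + l^2 S S^T: for z = H^-1 w with w a
   column of N, testing H z against z bounds both e |z| and l |S^T z|, whatever
   the singular values of S. *)
Lemma regularized_factor r n (S : 'M[R]_r) (N : 'M[R]_(r, n)) e l : 0 < e -> 0 <= l ->
  (forall x : 'cV[R]_r, frob (x^T *m N) <= e * frob x + l * frob (x^T *m S)) ->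
  exists D : 'M[R]_(r, n),
    frob (N - S *m D) <= n%:R * (2 * e) /\ frob D <= n%:R * (2 * l).
Proof.
move=> e0 l0 hN; pose H : 'M[R]_r := (e ^+ 2)%:M + l ^+ 2 *: (S *m S^T).
have quad (z : 'cV[R]_r) : fdot z (H *m z) = (e * frob z) ^+ 2 + (l * frob (S^T *m z)) ^+ 2.
  rewrite /H mulmxDl mul_scalar_mx -scalemxAl fdotDr !fdotZr -mulmxA.
  by rewrite !exprMn !frob_sqr (fdot_mull S^T) trmxK.
have uH : H \in unitmx.
  rewrite -row_free_unit -kermx_eq0; apply/eqP/row_matrixP => i; rewrite row0.
  have /sub_kermxP vH : (row i (kermx H) <= kermx H)%MS by apply: row_sub.
  set v := row i _ in vH *; apply: trmx_inj; rewrite trmx0; apply: frob_eq0.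
  have Ht : H^T = H.
    by rewrite /H raddfD /= tr_scalar_mx trmxZ trmx_mul trmxK.
  have : fdot v^T (H *m v^T) = 0.
    by rewrite -{1}Ht -trmx_mul vH trmx0 /fdot mulmx0 mxtrace0.
  rewrite quad => /eqP; rewrite paddr_eq0 ?sqr_ge0 // sqrf_eq0 mulf_eq0 gt_eqF //=.
  by case/andP => /eqP.
pose Z := invmx H *m N; exists (l ^+ 2 *: (S^T *m Z)).
(* With a = e |z| and b = l |S^T z| the test gives a^2 + b^2 <= a + b. *)
have col_bound j : e * frob (col j Z) <= 2 /\ l * frob (S^T *m col j Z) <= 2.
  set z := col j Z.
  have Hz : H *m z = col j N by rewrite /z !colE mulmxA /Z mulKVmx.
  have : fdot z (H *m z) <= e * frob z + l * frob (S^T *m z).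
    rewrite -(frob_tr (S^T *m z)) trmx_mul trmxK; apply: le_trans (hN z).
    apply: le_trans (entry_le_frob _ 0 j); apply: le_trans (ler_norm _).
    by rewrite Hz /fdot trace_mx11 !mxE; apply: ler_sum => k _; rewrite !mxE.
  rewrite quad; have := mulr_ge0 (ltW e0) (frob_ge0 z).
  have := mulr_ge0 l0 (frob_ge0 (S^T *m z)).
  move: (e * _) (l * _) => a b b0 a0 ab; rewrite !leNgt.
  by split; apply/negP => h; [have := sqr_ge0 (b - 1 / 2) | have := sqr_ge0 (a - 1 / 2)]; nra.
split; apply: frob_cols => j; have [ha hb] := col_bound j.
  have -> : N - S *m (l ^+ 2 *: (S^T *m Z)) = e ^+ 2 *: Z.
    have {1}-> : N = H *m Z by rewrite mulKVmx.
    by rewrite /H mulmxDl mul_scalar_mx -scalemxAl -scalemxAr (mulmxA S S^T Z) addrK.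
  rewrite linearZ /= frobZ ger0_norm ?sqr_ge0 //.
  by rewrite expr2 -mulrA mulrC ler_wpM2r // ltW.
rewrite linearZ /= frobZ ger0_norm ?sqr_ge0 // colE -mulmxA -colE.
by rewrite expr2 -mulrA mulrC ler_wpM2r.
Qed.

(** The updated matrix is K (V^T + tau D) with K = (Y + tau G) V and D from the
   regularized factorization of the row-space part of the field through the
   core: this matches the Euler step up to the normal part of the field, and
   the row space rotates at a speed that does not depend on the core. *)
Lemma projected_euler_step m n r (G : 'M[R]_(m, n) -> 'M[R]_(m, n)) eps e L b tau
    (Y : factors R m n r) :
  (r < m)%N -> (r <= n)%N -> nearly_tangent r G eps -> lipschitz_frob G L -> 0 <= L ->
  frob (G (fac_mx Y)) <= b -> orth_factors Y -> 0 < e -> eps <= e -> 0 <= tau ->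
  exists Y' : factors R m n r, [/\ orth_factors Y',
    frob (fac_mx Y' - fac_mx Y - tau *: G (fac_mx Y))
      <= tau * ((1 + 2 * n%:R) * e + 2 * n%:R * L * b * tau)
    & frob (facV Y' *m (facV Y')^T - facV Y *m (facV Y)^T) <= 4 * n%:R * L * tau].
Proof.
move=> rm rn hG hL L0; case: Y => U S V hb [/= hU hV] e0 le_eps tau0.
set Y := fac_mx _ in hb *; set g := G Y in hb *.
pose Q := 1%:M - V *m V^T; pose N := U^T *m g *m Q.
have hN (x : 'cV[R]_r) : frob (x^T *m N) <= e * frob x + L * frob (x^T *m S).
  have := @nearly_tangent_dir m n r G eps L (Factors U S V) x rm hG hL L0 (conj hU hV).
  move=> /= h; apply: le_trans h _; rewrite lerD2r ler_wpM2r ?frob_ge0 //.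
have [D [hD1 hD2]] := regularized_factor e0 L0 hN.
pose K := U *m S + tau *: (g *m V); pose W := V^T + tau *: D.
have [U' [A [hU' KE]]] := qr_factor K (ltnW rm).
have [V' [B [hV' WE]]] := qr_factor W^T rn.
have WE' : W = B^T *m V'^T by rewrite -trmx_mul -WE trmxK.
have Y'E : fac_mx (Factors U' (A *m B^T) V') = K *m W.
  by rewrite /fac_mx /= KE WE' !mulmxA.
exists (Factors U' (A *m B^T) V'); split => //=.
  rewrite Y'E.
  have -> : K *m W - Y - tau *: g =
     - (tau *: ((1%:M - U *m U^T) *m g *m Q)) - tau *: (U *m (N - S *m D))
     + tau ^+ 2 *: (g *m V *m D).
    have -> : K *m W = Y + tau *: (U *m S *m D) + tau *: (g *m V *m V^T)
        + tau ^+ 2 *: (g *m V *m D).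
      rewrite /K /W (mulmxDl (U *m S)) (mulmxDr (U *m S)) (mulmxDr (tau *: _)).
      by rewrite -!scalemxAl -!scalemxAr scalerA addrA.
    have -> : (1%:M - U *m U^T) *m g *m Q = g - g *m V *m V^T - U *m N.
      rewrite (mulmxBl 1%:M) mul1mx (mulmxBl g) /N !mulmxA; congr (_ - _).
      by rewrite /Q mulmxBr mulmx1 mulmxA.
    rewrite (mulmxBr U N) (mulmxA U S D).
    move: (U *m S *m D) (g *m V *m V^T) (g *m V *m D) (U *m N) => a1 a2 a3 a4.
    by apply/matrixP => i j; rewrite !mxE; ring.
  have n0 : 0 <= n%:R :> R by [].
  have b1 : frob (tau *: ((1%:M - U *m U^T) *m g *m Q)) <= tau * e.
    rewrite frobZ ger0_norm // ler_wpM2l //; apply: le_trans le_eps.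
    exact: (@nearly_tangent_singular m n r G eps L (Factors U S V) hG hL L0 (conj hU hV)).
  have b2 : frob (tau *: (U *m (N - S *m D))) <= tau * (n%:R * (2 * e)).
    by rewrite frobZ ger0_norm // ler_wpM2l // frob_orth.
  have b3 : frob (tau ^+ 2 *: (g *m V *m D)) <= tau ^+ 2 * (b * (n%:R * (2 * L))).
    rewrite frobZ ger0_norm ?sqr_ge0 // ler_wpM2l ?sqr_ge0 // -mulmxA.
    apply: le_trans (frobM _ _) _; rewrite frob_orth //.
    by apply: ler_pM => //; exact: frob_ge0.
  have -> : tau * ((1 + 2 * n%:R) * e + 2 * n%:R * L * b * tau) =
      tau * e + tau * (n%:R * (2 * e)) + tau ^+ 2 * (b * (n%:R * (2 * L))) by ring.
  apply: le_trans (frobD _ _) _; apply: lerD => //.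
  by apply: le_trans (frobB _ _) _; rewrite frobN; apply: lerD.
have -> : 4 * n%:R * L * tau = 2 * (tau * (n%:R * (2 * L))) by ring.
apply: le_trans (proj_dist hV hV') _; rewrite ler_wpM2l //.
(* W has the row space of V', so V V^T (1 - V' V'^T) only sees tau D. *)
have WQ : W *m (1%:M - V' *m V'^T) = 0.
  by rewrite WE' mulmxBr mulmx1 -(mulmxA B^T) (mulmxA V'^T) hV' mul1mx subrr.
have -> : V *m V^T *m (1%:M - V' *m V'^T) = - (tau *: (V *m (D *m (1%:M - V' *m V'^T)))).
  have VE : V^T = W - tau *: D by rewrite /W addrK.
  rewrite VE -mulmxA mulmxBl WQ sub0r mulmxN -scalemxAl -scalemxAr //.
rewrite frobN frobZ ger0_norm // ler_wpM2l // frob_orth //.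
by apply: le_trans hD2; apply: frob_projr.
Qed.

(** * Quasi-optimality of the reduced K-L step *)

(** The output is U1 U1^T A with A = Y0 + dA, and P = 1 - U1 U1^T annihilates
   A V0.  If X has a row space close to that of V0, then P X is controlled by
   P X V0 V0^T = P (X - A) V0 V0^T. *)
Lemma KL_step_quasi_optimal m n r (Y0 Y1 : factors R m n r) dA (X : 'M[R]_(m, n))
    (W : 'M[R]_(n, r)) :
  KL_step Y0 dA Y1 -> orthonormal_cols (facV Y0) ->
  X = X *m (W *m W^T) ->
  frob (W *m W^T - facV Y0 *m (facV Y0)^T) <= 1 / 2 ->
  frob (fac_mx Y1 - (fac_mx Y0 + dA)) <= 3 * frob (fac_mx Y0 + dA - X).
Proof.
case: Y0 Y1 => U0 S0 V0 [U1 S1 V1] [/= hU1 [Sh hSh] hV1 hL] hV0 XW.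
set A := fac_mx _ + dA; set P0 := V0 *m V0^T => hW.
set P := 1%:M - U1 *m U1^T.
have Y1E : fac_mx (Factors U1 S1 V1) = U1 *m U1^T *m A.
  rewrite /fac_mx /= -mulmxA -[S1 *m _]trmxK trmx_mul trmxK hL /L_mx /= raddfD /=.
  by rewrite !trmx_mul !trmxK -(mulmxA U1 U1^T) /A /fac_mx /= (mulmxDr U1^T) !mulmxA.
have PAV : P *m A *m V0 = 0.
  have -> : P *m A *m V0 = P *m K_mx (Factors U0 S0 V0) dA.
    rewrite -(mulmxA P A V0); congr (P *m _).
    by rewrite /A /K_mx /fac_mx /= mulmxDl -(mulmxA (U0 *m S0)) hV0 mulmx1.
  by rewrite -hSh /P mulmxA mulmxBl mul1mx -(mulmxA U1) hU1 mulmx1 subrr mul0mx.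
set E := A - X.
(* P X = P X P0 + P X (W W^T) (1 - P0): the first term equals - P E P0, the
   second is at most half of P X. *)
have PX : frob (P *m X) <= frob E + frob (P *m X) * (1 / 2).
  have {1}-> : P *m X = - (P *m E *m P0) + P *m X *m ((W *m W^T - P0) *m (1%:M - P0)).
    have PAP0 : P *m A *m P0 = 0 by rewrite /P0 mulmxA PAV mul0mx.
    have -> : P *m E *m P0 = - (P *m X *m P0).
      by rewrite /E mulmxBr mulmxBl PAP0 sub0r.
    have P00 : P0 *m (1%:M - P0) = 0.
      by rewrite /P0 mulmxBr mulmx1 mulmxA -(mulmxA V0) hV0 mulmx1 subrr.
    have -> : (W *m W^T - P0) *m (1%:M - P0) = W *m W^T *m (1%:M - P0).
      by rewrite (mulmxBl (W *m W^T)) P00 subr0.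
    rewrite opprK (mulmxA (P *m X) (W *m W^T)) -(mulmxA P X (W *m _)) -XW.
    by rewrite (mulmxBr (P *m X)) mulmx1 addrC subrK.
  apply: le_trans (frobD _ _) _; apply: lerD.
    rewrite frobN /P0 mulmxA frob_orthT // -frob_tr trmx_mul.
    have := frob_orth (V0^T *m (P *m E)^T) hV0; rewrite mulmxA => <-.
    case: (frob_proj (P *m E)^T hV0) => _ h; apply: le_trans h _.
    by rewrite frob_tr frob_projl.
  apply: le_trans (frobM _ _) _; rewrite ler_wpM2l ?frob_ge0 //.
  by apply: le_trans hW; apply: frob_projr.
have -> : fac_mx (Factors U1 S1 V1) - A = - (P *m X) - P *m E.
  have XE : X + E = A by rewrite /E addrC subrK.
  by rewrite Y1E -opprD -(mulmxDr P) XE /P mulmxBl mul1mx opprB.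
apply: le_trans (frobB _ _) _; rewrite frobN.
have : frob (P *m E) <= frob E by apply: frob_projl.
have := frob_ge0 E; lra.
Qed.

End Tangency.

(** * Mean value inequalities *)

Section MeanValue.
Variable R : realType.

Lemma quot_within_entry m n (D : set R) (f : R -> 'M[R]_(m, n)) t
    (G : 'M[R]_(m, n)) i j e :
  quot_within D f t --> G -> 0 < e ->
  exists2 d, 0 < d & forall s, `|s - t| < d -> s != t -> D s ->
    `|(s - t)^-1 * (f s i j - f t i j) - G i j| < e.
Proof.
move=> hq e0; have := hq _ (nbhsx_ballx G e e0).
rewrite /quot_within nbhs_simpl /= /within /= => /nbhs_ballP [d d0 hd].
exists d => // s sd st Ds.
have sd' : ball t d s by rewrite /ball /= distrC.
have [_ /(_ i j)] := hd s sd' st Ds.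
by rewrite /ball /= !mxE distrC.
Qed.

(** One-sided difference quotients at the end points are enough: they give
   continuity on the closed interval. *)
Lemma mean_value_within (f g : R -> R) a b : a < b ->
  (forall t, t \in `[a, b] -> forall e, 0 < e ->
     exists2 d, 0 < d & forall s, `|s - t| < d -> s != t -> s \in `[a, b] ->
       `|(s - t)^-1 * (f s - f t) - g t| < e) ->
  exists2 c, c \in `[a, b] & f b - f a = g c * (b - a).
Proof.
move=> ab hf.
have df x : x \in `]a, b[ -> is_derive x 1 f (g x).
  move=> xab; have xab' : x \in `[a, b] by apply: subset_itv_oo_cc.
  have ax : a < x by rewrite (itvP xab).
  have xb : x < b by rewrite (itvP xab).
  suff h : (fun h => h^-1 *: ((f \o shift x) (h *: 1) - f x)) @ 0^' --> g x.
    by apply: DeriveDef; [apply: cvgP h | apply: cvg_lim].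
  apply/cvgrPdist_lt => e e0; have [d d0 hd] := hf x xab' e e0.
  rewrite near_withinE; apply/nbhs_ballP.
  exists (Num.min d (Num.min (x - a) (b - x))) => [|h /=].
    by rewrite /= !lt_min d0 !subr_gt0 ax xb.
  rewrite /ball /= sub0r normrN !lt_min => /and3P [h1 h2 h3] hN0.
  have := hd (h + x); rewrite addrK => /(_ h1).
  rewrite -subr_eq0 addrK hN0 => /(_ isT); rewrite /= distrC scaler1 -[_ *: _]/(_ * _).
  apply; rewrite in_itv /=.
  by move: h2 h3; rewrite !ltr_norml; lra.
have cf : {within `[a, b], continuous f}.
  apply/subspace_continuousP => x /= xab.
  have [d d0 hd] := hf x xab 1 ltr01.
  apply/cvgrPdist_lt => e e0; rewrite near_withinE; apply/nbhs_ballP.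
  (* The quotients near x are within 1 of g x, so they are bounded by k. *)
  pose k := `|g x| + 1; have k0 : 0 < k by rewrite ltr_wpDl.
  exists (Num.min d (e / k)) => [|s /=]; first by rewrite /= lt_min d0 divr_gt0.
  rewrite /ball /= distrC lt_min => /andP [h1 h2] sab.
  have [->|sx] := eqVneq s x; first by rewrite subrr normr0.
  have := hd s h1 sx sab; set q := _^-1 * _ => hq.
  have -> : f x - f s = - ((s - x) * q).
    by rewrite /q mulrA mulfV ?subr_eq0 // mul1r opprB.
  have qk : `|q| < k.
    have := ler_normD (q - g x) (g x); rewrite subrK /k => h; lra.
  rewrite normrN normrM; apply: le_lt_trans (_ : `|s - x| * k < _).
    by rewrite ler_wpM2l // ltW.
  by rewrite -ltr_pdivlMr.
have [c cab h] := MVT ab df cf.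
by exists c => //; apply: subset_itv_oo_cc.
Qed.

(** The mean value theorem fails for matrix-valued maps; applying it entrywise
   costs the factor m * n. *)
Lemma mean_value_ineq m n (D : set R) (f g : R -> 'M[R]_(m, n)) a b v K : a <= b ->
  `[a, b] `<=` D -> 0 <= K ->
  (forall t, t \in `[a, b] -> quot_within D f t --> g t) ->
  (forall t, t \in `[a, b] -> frob (g t - v) <= K) ->
  frob (f b - f a - (b - a) *: v) <= (m * n)%:R * (K * (b - a)).
Proof.
move=> ab abD K0 hf hg.
have [->|aNb] := eqVneq a b.
  by rewrite !subrr scale0r subrr frob0 !mulr0.
have {aNb}ltab : a < b by rewrite lt_def eq_sym aNb.
have ba : 0 <= b - a by rewrite subr_ge0.
apply: frob_entries => [|i j]; first by rewrite mulr_ge0.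
have [|c cab hc] := @mean_value_within (fun s => f s i j) (fun s => g s i j) a b ltab.
  move=> t tab e e0; have [d d0 hd] := quot_within_entry i j (hf t tab) e0.
  by exists d => // s sd st sab; apply: hd => //; apply: abD.
rewrite !mxE hc mulrC -mulrBr normrM ger0_norm // mulrC ler_wpM2r //.
by have := entry_le_frob (g c - v) i j; rewrite !mxE => h; apply: le_trans h (hg c cab).
Qed.

End MeanValue.

(** * Second-order expansion of the field *)

Section Taylor.
Variables (R : realType) (m n : nat) (T M b : R).
Variable F : R -> 'M[R]_(m, n) -> 'M[R]_(m, n).
Hypothesis M0 : 0 <= M.
Hypothesis b1 : 1 <= b.
Hypothesis F_bound : forall t X, t \in `[0, T] -> frob (F t X) <= b.
Hypothesis F_C2 : class_C 2 T F.
Hypothesis F_der : forall (a b : nat) t X, (1 <= a + b <= 2)%N -> t \in `[0, T] ->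
  (multilin_norm (@mixed_partial R m n T F a b t X) <= M%:E)%E.

Lemma multilin_norm_le c (A : c.-tuple 'M[R]_(m, n) -> 'M[R]_(m, n)) Hs :
  (multilin_norm A <= M%:E)%E -> (forall i, frob (tnth Hs i) <= 1) -> frob (A Hs) <= M.
Proof.
move=> hA hHs; rewrite -lee_fin; apply: le_trans hA.
by apply: ereal_sup_ubound; exists Hs.
Qed.

Implicit Types (G : R -> 'M[R]_(m, n) -> 'M[R]_(m, n)) (X H : 'M[R]_(m, n)).

Lemma class_C_time k G t X : class_C k.+1 T G -> t \in `[0, T] ->
  quot_within `[0, T] (G ^~ X) t --> partial_t T G t X.
Proof. by case=> _ [hG _ _ _] tT; exact: hG. Qed.

Lemma class_C_ray k G t X H (D : set R) x : class_C k.+1 T G -> t \in `[0, T] ->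
  quot_within D (fun x => G t (X + x *: H)) x --> partial_X H G t (X + x *: H).
Proof.
case=> _ [_ hG _ _] tT; have dG := hG t (X + x *: H) tT.
rewrite /partial_X -deriveE //.
have h : (fun h => h^-1 *: ((G t \o shift (X + x *: H)) (h *: H) - G t (X + x *: H))) @ 0^'
    --> 'D_H (G t) (X + x *: H) by exact: diff_derivable.
move=> P /h; rewrite /quot_within !nbhs_simpl /= /within /= => /nbhs_ballP [d d0 hd].
apply/nbhs_ballP; exists d => // s; rewrite /ball /= => sx sNx _.
have := hd (s - x); rewrite /ball /= sub0r opprB => /(_ sx).
rewrite subr_eq0 => /(_ sNx).
by rewrite /shift /= addrCA -scalerDl subrK.
Qed.

Lemma partial_bounds t X H : t \in `[0, T] -> frob H <= 1 ->
  [/\ frob (partial_t T F t X) <= M, frob (partial_X H F t X) <= M,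
    frob (partial_t T (partial_t T F) t X) <= M,
    frob (partial_t T (partial_X H F) t X) <= M &
    frob (partial_X H (partial_X H F) t X) <= M].
Proof.
move=> tT hH; split.
- by apply: (@multilin_norm_le _ _ [tuple]) (@F_der 1 0 t X isT tT) _; case.
- apply: (@multilin_norm_le _ _ [tuple H]) (@F_der 0 1 t X isT tT) _ => i.
  by rewrite (tnth_nth 0); case: i => - [].
- by apply: (@multilin_norm_le _ _ [tuple]) (@F_der 2 0 t X isT tT) _; case.
- apply: (@multilin_norm_le _ _ [tuple H]) (@F_der 1 1 t X isT tT) _ => i.
  by rewrite (tnth_nth 0); case: i => - [].
- apply: (@multilin_norm_le _ _ [tuple H; H]) (@F_der 0 2 t X isT tT) _ => i.
  by rewrite (tnth_nth 0); case: i => - [|[]].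
Qed.

Let k : R := (m * n)%:R.

Lemma in_sub0T t s u : 0 <= t -> t + s <= T -> u \in `[t, t + s] -> u \in `[0, T].
Proof. by move=> t0 ts; rewrite !in_itv /=; lra. Qed.

Lemma sub0T t s : 0 <= t -> t + s <= T -> `[t, t + s] `<=` `[0, T].
Proof. by move=> t0 ts u /= ; apply: in_sub0T. Qed.

Lemma time_increment j G K t s X : class_C j.+1 T G -> 0 <= K ->
  (forall u, u \in `[0, T] -> frob (partial_t T G u X) <= K) ->
  0 <= t -> 0 <= s -> t + s <= T -> frob (G (t + s) X - G t X) <= k * (K * s).
Proof.
move=> hG K0 hK t0 s0 ts.
have := @mean_value_ineq R m n `[0, T] (G ^~ X) (partial_t T G ^~ X) t (t + s) 0 K.
rewrite scaler0 subr0 addrAC subrr add0r; apply => //; first by rewrite lerDl.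
- exact: sub0T.
- by move=> u /(in_sub0T t0 ts) uT; apply: class_C_time hG uT.
- by move=> u /(in_sub0T t0 ts) uT; rewrite subr0 hK.
Qed.

Lemma F_time_lip t s X : 0 <= t -> 0 <= s -> t + s <= T ->
  frob (F (t + s) X - F t X) <= k * M * s.
Proof.
move=> t0 s0 ts; rewrite -mulrA; apply: time_increment F_C2 _ _ _ _ _ => // u uT.
by have [] := @partial_bounds u X 0 uT; rewrite ?frob0.
Qed.

(** The increment splits into one in X at time t + s, one in t at X, and the
   variation of D_X F (t, X) H between t and t + s. *)
Lemma F_taylor t s x X H : frob H <= 1 -> 0 <= t -> 0 <= s -> 0 <= x -> t + s <= T ->
  frob (F (t + s) (X + x *: H) - F t X - s *: partial_t T F t X - x *: partial_X H F t X)
    <= (k ^+ 2 + k) * M * (s + x) ^+ 2.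
Proof.
move=> hH t0 s0 x0 ts; have k0 : 0 <= k by exact: ler0n.
have tT : t \in `[0, T] by rewrite in_itv /=; lra.
have tsT : t + s \in `[0, T] by rewrite in_itv /=; lra.
have Ct : class_C 1 T (partial_t T F) by case: F_C2 => _ [_ _ h _]; exact: h.
have CX K : class_C 1 T (partial_X K F) by case: F_C2 => _ [_ _ _]; apply.
have h1 : frob (F (t + s) X - F t X - s *: partial_t T F t X) <= k * (k * M * s * s).
  have := @mean_value_ineq R m n `[0, T] (F ^~ X) (partial_t T F ^~ X) t (t + s)
    (partial_t T F t X) (k * M * s).
  rewrite [t + s - t]addrAC subrr add0r; apply.
  - by rewrite lerDl.
  - exact: sub0T.
  - by rewrite !mulr_ge0.
  - by move=> u /(in_sub0T t0 ts) uT; apply: class_C_time F_C2 uT.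
  - move=> u us; have uT := in_sub0T t0 ts us.
    have tu : t <= u by rewrite (itvP us).
    have us' : u <= t + s by rewrite (itvP us).
    have := @time_increment _ _ M t (u - t) X Ct M0.
    rewrite addrCA subrr addr0 => h; apply: le_trans (h _ _ _ _) _ => //.
    + by move=> w wT; have [] := @partial_bounds w X 0 wT; rewrite ?frob0.
    + by rewrite subr_ge0.
    + by rewrite (itvP uT).
    + by rewrite mulrA ler_wpM2l ?mulr_ge0 // lerBlDl.
have h2 : frob (F (t + s) (X + x *: H) - F (t + s) X - x *: partial_X H F (t + s) X)
    <= k * (k * M * x * x).
  have ray y : 0 <= y ->
      frob (partial_X H F (t + s) (X + y *: H) - partial_X H F (t + s) X) <= k * (M * y).
    move=> y0; have := @mean_value_ineq R m n `[0, y]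
      (fun z => partial_X H F (t + s) (X + z *: H))
      (fun z => partial_X H (partial_X H F) (t + s) (X + z *: H)) 0 y 0 M y0.
    rewrite scaler0 !subr0 scale0r addr0; apply => //.
    - by move=> z _; apply: class_C_ray (CX H) tsT.
    - by move=> z _; rewrite subr0; have [] := @partial_bounds _ (X + z *: H) H tsT hH.
  have := @mean_value_ineq R m n `[0, x]
      (fun z => F (t + s) (X + z *: H))
      (fun z => partial_X H F (t + s) (X + z *: H)) 0 x (partial_X H F (t + s) X)
      (k * M * x) x0.
  rewrite !subr0 scale0r addr0; apply => //.
  - by rewrite !mulr_ge0.
  - by move=> z _; apply: class_C_ray F_C2 tsT.
  - move=> z zx; apply: le_trans (ray z _) _; first by rewrite (itvP zx).
    by rewrite mulrA ler_wpM2l ?mulr_ge0 // (itvP zx).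
have h3 : frob (partial_X H F (t + s) X - partial_X H F t X) <= k * (M * s).
  apply: time_increment (CX H) M0 _ _ _ _ => // u uT.
  by have [] := @partial_bounds u X H uT hH.
have -> : F (t + s) (X + x *: H) - F t X - s *: partial_t T F t X - x *: partial_X H F t X =
    (F (t + s) (X + x *: H) - F (t + s) X - x *: partial_X H F (t + s) X) +
    (F (t + s) X - F t X - s *: partial_t T F t X) +
    x *: (partial_X H F (t + s) X - partial_X H F t X).
  move: (F _ _) (F (t + s) X) (F t X) (partial_t _ _ _ _) (partial_X _ _ (t + s) _)
    (partial_X _ _ _ _) => a1 a2 a3 a4 a5 a6.
  by apply/matrixP => i j; rewrite !mxE; ring.
apply: le_trans (frobD _ _) _; apply: le_trans (lerD (frobD _ _) (lexx _)) _.
rewrite frobZ ger0_norm //.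
apply: le_trans (lerD (lerD h2 h1) (ler_wpM2l x0 h3)) _.
have kM : 0 <= k * M by rewrite mulr_ge0.
have kkM : 0 <= k * k * M by rewrite mulr_ge0 // mulr_ge0.
have sx : 0 <= s * x by rewrite mulr_ge0.
have -> : (k ^+ 2 + k) * M * (s + x) ^+ 2 =
  k * (k * M * x * x) + k * (k * M * s * s) + x * (k * (M * s)) +
  (2 * (k * k * M) * (s * x) + k * M * (s * x) + k * M * (x * x) + k * M * (s * s)) by ring.
by rewrite lerDl !addr_ge0 // !mulr_ge0.
Qed.

(** G is the second derivative at s = 0 of the solution through (t, Y). *)
Lemma second_derivative t Y : 0 <= t -> t <= T ->
  exists2 G : 'M[R]_(m, n), frob G <= M * (1 + b) &
    forall s, 0 <= s -> t + s <= T ->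
      frob (F (t + s) (Y + s *: F t Y) - F t Y - s *: G)
        <= (k ^+ 2 + k) * M * (1 + b) ^+ 2 * s ^+ 2.
Proof.
move=> t0 tleT; have tT : t \in `[0, T] by rewrite in_itv /=; lra.
have bg0 : 0 < b by apply: lt_le_trans b1.
(* The bounds on derivatives are for directions of norm at most 1. *)
pose H := b^-1 *: F t Y.
have hH : frob H <= 1.
  by rewrite frobZ gtr0_norm ?invr_gt0 // mulrC ler_pdivrMr // mul1r F_bound.
have bH : b *: H = F t Y by rewrite /H scalerA divff ?scale1r // gt_eqF.
exists (partial_t T F t Y + b *: partial_X H F t Y).
  have [h1 h2 _ _ _] := @partial_bounds t Y H tT hH.
  apply: le_trans (frobD _ _) _; rewrite frobZ gtr0_norm // mulrDr mulr1 (mulrC M).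
  by rewrite lerD // ler_wpM2l // ltW.
move=> s s0 ts; have sb : 0 <= s * b by rewrite mulr_ge0 // ltW.
have := F_taylor Y hH t0 s0 sb ts; rewrite -scalerA bH -mulrA.
have -> : (s + s * b) ^+ 2 = (1 + b) ^+ 2 * s ^+ 2 by ring.
by rewrite -mulrA scalerDr opprD addrA scalerA !mulrA.
Qed.

End Taylor.

(** * Perturbed Euler polygons *)

Lemma discrete_gronwall (R : realType) (e : nat -> R) a c N :
  0 <= a -> 0 <= c -> 0 <= e 0%N ->
  (forall k, (k < N)%N -> e k.+1 <= (1 + a) * e k + c) ->
  e N <= expR (a * N%:R) * (e 0%N + N%:R * c).
Proof.
move=> a0 c0 e0; elim: N => [|N IH] he.
  by rewrite mulr0 expR0 mul1r mul0r addr0.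
have hN := IH (fun k kN => he k (ltnW kN)).
apply: le_trans (he N (ltnSn N)) _.
have E0 : 0 <= e 0%N + N%:R * c by rewrite addr_ge0 // mulr_ge0.
have h1 : (1 + a) * e N <= expR (a * N.+1%:R) * (e 0%N + N%:R * c).
  have -> : a * N.+1%:R = a + a * N%:R by rewrite -natr1; ring.
  rewrite expRD -mulrA; apply: le_trans (ler_wpM2l _ hN) _; first by rewrite addr_ge0.
  by rewrite ler_wpM2r ?expR_ge1Dx // mulr_ge0 // expR_ge0.
have h2 : c <= expR (a * N.+1%:R) * c.
  by rewrite ler_peMl //; apply: le_trans (expR_ge1Dx _); rewrite lerDl mulr_ge0.
have -> : e 0%N + N.+1%:R * c = (e 0%N + N%:R * c) + c by rewrite -natr1; ring.
by rewrite mulrDr; apply: lerD.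
Qed.

Section Euler.
Variables (R : realType) (m n : nat) (T M L b : R).
Variable F : R -> 'M[R]_(m, n) -> 'M[R]_(m, n).
Hypothesis M0 : 0 <= M.
Hypothesis L0 : 0 <= L.
Hypothesis b1 : 1 <= b.
Hypothesis F_bound : forall t X, t \in `[0, T] -> frob (F t X) <= b.
Hypothesis F_lip : forall t, t \in `[0, T] -> lipschitz_frob (F t) L.
Hypothesis F_C2 : class_C 2 T F.
Hypothesis F_der : forall (a b : nat) t X, (1 <= a + b <= 2)%N -> t \in `[0, T] ->
  (multilin_norm (@mixed_partial R m n T F a b t X) <= M%:E)%E.

Let k : R := (m * n)%:R.

(** The constants of the error bounds are named so that they visibly depend on
   m, n, M, L and b only: cTaylor bounds the defect of the quadratic expansion
   along a ray, cDefect that of the Taylor polynomial as a solution, cEuler the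
   second-order error of Euler steps along a solution, and cSolution h^3 is the
   classical local error of the midpoint rule. *)
Definition cTaylor : R := (k ^+ 2 + k) * M * (1 + b) ^+ 2.
Definition cDefect : R := cTaylor + (L + 1) * (M * (1 + b)).

Lemma cTaylor_ge0 : 0 <= cTaylor.
Proof.
apply: mulr_ge0; last exact: sqr_ge0.
by apply: mulr_ge0 => //; apply: addr_ge0; [exact: sqr_ge0|exact: ler0n].
Qed.

Lemma cDefect_ge0 : 0 <= cDefect.
Proof.
have bg : 0 <= 1 + b by have := b1; lra.
by rewrite addr_ge0 ?cTaylor_ge0 // !mulr_ge0 // addr_ge0.
Qed.

(** The quadratic Taylor polynomial p of the solution through (t, Y) satisfies
   the equation up to a defect s^2.  Every polygon of N steps tau = h / N with
   small defects is therefore close to p at h, and so are the midpoint rule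
   and the exact solution. *)
Lemma quadratic_approximation t Y : 0 <= t -> t <= T ->
  exists p : R -> 'M[R]_(m, n),
  [/\ p 0 = Y,
    forall s tau, 0 <= s -> 0 <= tau -> t + s <= T ->
      frob (p (s + tau) - p s - tau *: F (t + s) (p s)) <= tau * (cDefect * (s ^+ 2 + tau)) &
    forall h, 0 <= h -> t + h <= T ->
      frob (Y + h *: F (t + h / 2) (Y + (h / 2) *: F t Y) - p h) <= cTaylor * h ^+ 3].
Proof.
move=> t0 tT; have [G hG1 hG2] := second_derivative M0 b1 F_bound F_C2 F_der Y t0 tT.
exists (fun s => Y + s *: F t Y + (s ^+ 2 / 2) *: G); split.
- by rewrite expr0n /= mul0r !scale0r !addr0.
- move=> s tau s0 tau0 ts; set f := F t Y in hG2 *.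
  set p := Y + s *: f + _; have tsT : t + s \in `[0, T] by rewrite in_itv /=; lra.
  set F1 := F (t + s) (Y + s *: f) in hG2.
  have e1 : frob (F1 - f - s *: G) <= cTaylor * s ^+ 2 by apply: hG2.
  have e2 : frob (F1 - F (t + s) p) <= L * (s ^+ 2 / 2 * frob G).
    apply: le_trans (F_lip tsT _ _) _; rewrite ler_wpM2l // /p opprD addNKr.
    by rewrite frobN frobZ ger0_norm // divr_ge0 ?sqr_ge0.
  have -> : Y + (s + tau) *: f + ((s + tau) ^+ 2 / 2) *: G - p - tau *: F (t + s) p =
      tau *: (F1 - F (t + s) p) - tau *: (F1 - f - s *: G) + (tau ^+ 2 / 2) *: G.
    have id (Y0 f0 f1 f2 G0 : 'M[R]_(m, n)) :
        Y0 + (s + tau) *: f0 + ((s + tau) ^+ 2 / 2) *: G0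
          - (Y0 + s *: f0 + (s ^+ 2 / 2) *: G0) - tau *: f2 =
        tau *: (f1 - f2) - tau *: (f1 - f0 - s *: G0) + (tau ^+ 2 / 2) *: G0.
      by apply/matrixP => i j; rewrite !mxE; field.
    exact: id.
  apply: le_trans (frobD _ _) _; apply: le_trans (lerD (frobB _ _) (lexx _)) _.
  rewrite !frobZ !(ger0_norm tau0) (ger0_norm (_ : 0 <= tau ^+ 2 / 2)); last first.
    by rewrite divr_ge0 ?sqr_ge0.
  have g0 := frob_ge0 G; set g := frob G in hG1 g0 e2 *; set mb := M * (1 + b) in hG1 *.
  apply: le_trans (lerD (lerD (ler_wpM2l tau0 e2) (ler_wpM2l tau0 e1)) (lexx _)) _.
  rewrite /cDefect -/mb; have c0 := cTaylor_ge0.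
  have -> : tau * (L * (s ^+ 2 / 2 * g)) + tau * (cTaylor * s ^+ 2) + tau ^+ 2 / 2 * g =
    tau * (cTaylor * s ^+ 2 + (L * (s ^+ 2) + tau) * (g / 2)) by field.
  rewrite ler_wpM2l //.
  have s2 := sqr_ge0 s; have Ls : 0 <= L * s ^+ 2 by rewrite mulr_ge0.
  have mb0 : 0 <= mb by apply: le_trans hG1.
  have Lt : 0 <= L * tau by rewrite mulr_ge0.
  have h1 : (L * (s ^+ 2) + tau) * (g / 2) <= (L * (s ^+ 2) + tau) * mb.
    by rewrite ler_wpM2l ?addr_ge0 //; lra.
  have h2 : 0 <= cTaylor * tau by rewrite mulr_ge0.
  have h3 : 0 <= L * tau * mb by rewrite mulr_ge0.
  have h4 : 0 <= s ^+ 2 * mb by rewrite mulr_ge0.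
  have -> : (cTaylor + (L + 1) * mb) * (s ^+ 2 + tau) =
    cTaylor * s ^+ 2 + (L * s ^+ 2 + tau) * mb + (cTaylor * tau + L * tau * mb + s ^+ 2 * mb) by ring.
  by move: h1 h2 h3 h4; lra.
move=> h h0 th; set f := F t Y in hG2 *.
have h20 : 0 <= h / 2 by rewrite divr_ge0.
have := hG2 (h / 2) h20; rewrite -/k -/cTaylor => /(_ ltac:(lra)) e1.
have -> : Y + h *: F (t + h / 2) (Y + (h / 2) *: f) - (Y + h *: f + (h ^+ 2 / 2) *: G) =
   h *: (F (t + h / 2) (Y + (h / 2) *: f) - f - (h / 2) *: G).
  move: (F _ _) => f1; move: (f) => f0.
  by apply/matrixP => i j; rewrite !mxE; field.
rewrite frobZ ger0_norm //; apply: le_trans (ler_wpM2l h0 e1) _.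
have -> : h * (cTaylor * (h / 2) ^+ 2) = cTaylor * h ^+ 3 / 4 by field.
have : 0 <= cTaylor * h ^+ 3 by rewrite mulr_ge0 ?cTaylor_ge0 // exprn_ge0.
lra.
Qed.

(** Both Z and p satisfy the Euler recursion up to a defect, and the Euler map is
   Lipschitz with constant 1 + tau L; Gronwall sums the defects. *)
Lemma perturbed_euler t tau d N (p : R -> 'M[R]_(m, n)) (Z : nat -> 'M[R]_(m, n)) :
  0 <= t -> 0 <= tau -> 0 <= d -> t + N%:R * tau <= T -> N%:R * tau <= 1 ->
  Z 0%N = p 0 ->
  (forall s tau, 0 <= s -> 0 <= tau -> t + s <= T ->
      frob (p (s + tau) - p s - tau *: F (t + s) (p s)) <= tau * (cDefect * (s ^+ 2 + tau))) ->
  (forall j, (j < N)%N ->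
     frob (Z j.+1 - Z j - tau *: F (t + j%:R * tau) (Z j)) <= tau * d) ->
  frob (Z N - p (N%:R * tau))
    <= expR L * (N%:R * tau * (d + cDefect * ((N%:R * tau) ^+ 2 + tau))).
Proof.
move=> t0 tau0 d0 tN N1 Z0 hp hZ; set h := N%:R * tau in tN N1 *.
have h0 : 0 <= h by rewrite mulr_ge0.
pose c := tau * (d + cDefect * (h ^+ 2 + tau)).
have c0 : 0 <= c by rewrite mulr_ge0 // addr_ge0 // mulr_ge0 ?cDefect_ge0 // addr_ge0 // sqr_ge0.
pose e j := frob (Z j - p (j%:R * tau)).
have e0 : e 0%N = 0 by rewrite /e mul0r Z0 subrr frob0.
have := @discrete_gronwall R e (tau * L) c N.
rewrite e0 add0r => /(_ (mulr_ge0 tau0 L0) c0 (lexx _)) H.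
apply: le_trans (H _) _; last first.
  have -> : N%:R * c = h * (d + cDefect * (h ^+ 2 + tau)) by rewrite /c /h; ring.
  rewrite ler_wpM2r //; last first.
    by rewrite ler_expR (_ : _ * _ * _ = L * h) ?ler_piMr // /h; ring.
  by rewrite mulr_ge0 // addr_ge0 // mulr_ge0 ?cDefect_ge0 // addr_ge0 // sqr_ge0.
move=> j jN; rewrite /e; set s := j%:R * tau.
have s0 : 0 <= s by rewrite mulr_ge0.
have sh : s <= h by rewrite ler_wpM2r // ler_nat ltnW.
have ts : t + s <= T by lra.
have tsT : t + s \in `[0, T] by rewrite in_itv /=; lra.
have -> : j.+1%:R * tau = s + tau by rewrite -natr1 mulrDl mul1r.
set z := Z j; set f1 := F (t + s) z; set f2 := F (t + s) (p s).
have -> : Z j.+1 - p (s + tau) = (Z j.+1 - z - tau *: f1) + (z - p s) + tau *: (f1 - f2)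
    - (p (s + tau) - p s - tau *: f2).
  move: (Z j.+1) z (p _) (p _) f1 f2 => a1 a2 a3 a4 a5 a6.
  by apply/matrixP => i l; rewrite !mxE; ring.
have q1 : frob (Z j.+1 - z - tau *: f1) <= tau * d by exact: hZ.
have q2 : frob (tau *: (f1 - f2)) <= tau * (L * frob (z - p s)).
  by rewrite frobZ ger0_norm // ler_wpM2l // F_lip.
have q3 := hp s tau s0 tau0 ts.
have q4 : tau * (cDefect * (s ^+ 2 + tau)) <= tau * (cDefect * (h ^+ 2 + tau)).
  by rewrite ler_wpM2l // ler_wpM2l ?cDefect_ge0 // lerD2r ler_sqr ?nnegrE.
apply: le_trans (frobB _ _) _.
apply: le_trans (lerD (frobD _ _) (lexx _)) _.
apply: le_trans (lerD (lerD (frobD _ _) (lexx _)) (lexx _)) _.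
rewrite /c; move: q1 q2 q3 q4; set x := frob (z - p s).
have -> : (1 + tau * L) * x + tau * (d + cDefect * (h ^+ 2 + tau)) =
   x + tau * (L * x) + tau * d + tau * (cDefect * (h ^+ 2 + tau)) by ring.
lra.
Qed.

Definition cEuler : R := k * (k * M + L * (k * b)).

Lemma cEuler_ge0 : 0 <= cEuler.
Proof.
have b0 : 0 <= b by apply: le_trans b1.
by rewrite /cEuler mulr_ge0 // addr_ge0 // !mulr_ge0.
Qed.

Lemma solution_euler_defect a1 a2 A0 A c s tau :
  ode_solution (fun s => F (c + s)) a1 a2 A0 A ->
  0 <= c + a1 -> c + a2 <= T -> a1 <= s -> 0 <= tau -> s + tau <= a2 ->
  frob (A (s + tau) - A s - tau *: F (c + s) (A s)) <= tau * (cEuler * tau).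
Proof.
move=> [_ hA] ca1 ca2 as1 tau0 sa2.
have b0 : 0 <= b by apply: le_trans b1.
have sub u v : a1 <= u -> v <= a2 -> `[u, v] `<=` `[a1, a2].
  by move=> au va w /=; rewrite !in_itv /=; lra.
have inT u : u \in `[a1, a2] -> c + u \in `[0, T] by rewrite !in_itv /=; lra.
have lipA u : s <= u -> u <= s + tau -> frob (A u - A s) <= k * (b * tau).
  move=> su us; have := @mean_value_ineq R m n `[a1, a2] A (fun s => F (c + s) (A s)) s u 0 b su.
  rewrite scaler0 subr0 => h; apply: le_trans (h _ _ _ _) _ => //.
  - by apply: sub => //; lra.
  - by move=> w wu; apply: hA; apply: sub wu => //; lra.
  - move=> w wu; rewrite subr0; apply: F_bound; apply: inT; apply: sub wu => //; lra.
  - by rewrite ler_wpM2l // ler_wpM2l //; lra.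
have sst : s <= s + tau by lra.
have := @mean_value_ineq R m n `[a1, a2] A (fun s => F (c + s) (A s)) s (s + tau)
  (F (c + s) (A s)) ((k * M + L * (k * b)) * tau) sst.
rewrite [s + tau - s]addrAC subrr add0r => h; apply: le_trans (h _ _ _ _) _.
- exact: sub.
- by rewrite mulr_ge0 // addr_ge0 // !mulr_ge0.
- by move=> w wu; apply: hA; apply: sub wu.
- move=> u us.
  have su : s <= u by rewrite (itvP us).
  have us' : u <= s + tau by rewrite (itvP us).
  have cuT : c + u \in `[0, T] by apply: inT; apply: sub us.
  apply: le_trans (frob_tri (F (c + u) (A s)) _ _) _; rewrite addrC mulrDl; apply: lerD.
    have := F_time_lip M0 F_C2 F_der (A s) (_ : 0 <= c + s) (_ : 0 <= u - s).
    rewrite (_ : c + s + (u - s) = c + u); last by ring.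
    move=> h'; apply: le_trans (h' _ _ _) _; [lra|lra| |].
      by move: cuT; rewrite in_itv /= => /andP [].
    by rewrite ler_wpM2l ?mulr_ge0 //; lra.
  apply: le_trans (F_lip cuT _ _) _; rewrite -!mulrA ler_wpM2l //; exact: lipA.
rewrite /cEuler -/k; have -> : k * ((k * M + L * (k * b)) * tau * tau) =
  tau * (k * (k * M + L * (k * b)) * tau) by ring.
by [].
Qed.

(** With tau <= h^2, the first-order error h tau of N Euler steps is O(h^3). *)
Lemma exists_substep h : 0 < h -> exists N (tau : R),
  [/\ N%:R * tau = h, 0 <= tau & tau <= h ^+ 2].
Proof.
move=> h0; pose N := (Num.truncn h^-1).+1.
have hN : h^-1 < N%:R by apply: truncnS_gt.
have N0 : 0 < N%:R :> R by apply: lt_trans hN; rewrite invr_gt0.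
exists N, (h / N%:R); split.
- by rewrite mulrC divfK // gt_eqF.
- by rewrite divr_ge0 // ltW.
- rewrite ler_pdivrMr // expr2 -mulrA ler_pMr //.
  by rewrite -ler_pdivrMl // mulr1 ltW.
Qed.

Definition cSolution : R := expR L * (cEuler + 2 * cDefect) + cTaylor.

Lemma solution_midpoint_error a1 a2 A0 A c s h :
  ode_solution (fun s => F (c + s)) a1 a2 A0 A ->
  0 <= c + a1 -> c + a2 <= T -> a1 <= s -> 0 < h <= 1 -> s + h <= a2 ->
  frob (A s + h *: F (c + s + h / 2) (A s + (h / 2) *: F (c + s) (A s)) - A (s + h))
    <= cSolution * h ^+ 3.
Proof.
move=> hA ca1 ca2 as1 /andP [h0 h1] sa2.
have cs0 : 0 <= c + s by lra.
have csh : c + s + h <= T by lra.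
have [||p [p0 p1 p2]] := @quadratic_approximation (c + s) (A s); [lra|lra|].
have [N [tau [Nt tau0 tauh]]] := exists_substep h0.
have c0 := cDefect_ge0; have a0 := cEuler_ge0.
have := @perturbed_euler (c + s) tau (cEuler * tau) N p (fun j => A (s + j%:R * tau)) cs0 tau0.
rewrite Nt mul0r addr0 p0 => H.
have {H} e1 : frob (A (s + h) - p h) <= expR L * (h * (cEuler * tau + cDefect * (h ^+ 2 + tau))).
  apply: H => //; first by rewrite mulr_ge0.
  move=> j jN; have sj : j.+1%:R * tau <= h by rewrite -Nt ler_wpM2r // ler_nat.
  have j0 : 0 <= j%:R * tau by rewrite mulr_ge0.
  have -> : s + j.+1%:R * tau = s + j%:R * tau + tau by rewrite -[j.+1%:R]natr1; ring.
  rewrite -(addrA c s).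
  apply: (solution_euler_defect hA) => //; first lra.
  by move: sj; rewrite -[j.+1%:R]natr1 mulrDl mul1r; lra.
have e2 := p2 h (ltW h0) csh.
apply: le_trans (frob_tri (p h) _ _) _; rewrite (frobC (p h)) /cSolution mulrDl addrC.
apply: lerD => //; apply: le_trans e1 _; rewrite -mulrA ler_wpM2l ?expR_ge0 //.
have -> : (cEuler + 2 * cDefect) * h ^+ 3 = h * (cEuler * h ^+ 2 + cDefect * (h ^+ 2 + h ^+ 2)) by ring.
by rewrite ler_wpM2l ?(ltW h0) // lerD // ler_wpM2l // lerD.
Qed.

Lemma midpoint_map_lip t h X Z : 0 <= t -> 0 <= h -> t + h <= T -> h * L <= 1 ->
  frob ((X + h *: F (t + h / 2) (X + (h / 2) *: F t X)) -
        (Z + h *: F (t + h / 2) (Z + (h / 2) *: F t Z))) <= (1 + 2 * L * h) * frob (X - Z).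
Proof.
move=> t0 h0 th hL; have tT : t \in `[0, T] by rewrite in_itv /=; lra.
have thT : t + h / 2 \in `[0, T] by rewrite in_itv /=; lra.
set x := frob (X - Z); have x0 : 0 <= x by exact: frob_ge0.
have h20 : 0 <= h / 2 by rewrite divr_ge0.
have e1 : frob ((X + (h / 2) *: F t X) - (Z + (h / 2) *: F t Z)) <= 2 * x.
  rewrite opprD addrACA -scalerBr; apply: le_trans (frobD _ _) _.
  rewrite frobZ ger0_norm //.
  have := ler_wpM2l h20 (F_lip tT X Z); rewrite -/x => q.
  have : h * L * x <= 1 * x by rewrite ler_wpM2r.
  rewrite mul1r; lra.
have e2 := le_trans (F_lip thT _ _) (ler_wpM2l L0 e1).
rewrite opprD addrACA -scalerBr; apply: le_trans (frobD _ _) _.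
rewrite frobZ ger0_norm // -/x; have := ler_wpM2l h0 e2; lra.
Qed.

(** * One projector-splitting midpoint step *)

Section Step.
Variables (r : nat) (eps : R).
Hypothesis r_lt_m : (r < m)%N.
Hypothesis r_le_n : (r <= n)%N.
Hypothesis eps0 : 0 <= eps.
Hypothesis F_tan : tangent_bound r T F eps.

(** cProj, cStage, cIncr and cStep belong to the projected Euler step, the stage
   value, the increment and the output of a midpoint step. *)
Definition cProj : R := 1 + 2 * n%:R + 2 * n%:R * L * b.

Lemma cProj_ge0 : 0 <= cProj.
Proof.
have b0 : 0 <= b by apply: le_trans b1.
by rewrite /cProj !addr_ge0 // !mulr_ge0.
Qed.

Lemma field_euler_step e tau t (Y : factors R m n r) :
  t \in `[0, T] -> orth_factors Y -> 0 < e -> eps <= e -> 0 <= tau ->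
  exists Y' : factors R m n r, [/\ orth_factors Y',
    frob (fac_mx Y' - fac_mx Y - tau *: F t (fac_mx Y)) <= tau * (cProj * (e + tau))
    & frob (facV Y' *m (facV Y')^T - facV Y *m (facV Y)^T) <= 4 * n%:R * L * tau].
Proof.
move=> tT hY e0 le_e tau0.
have hG : nearly_tangent r (F t) eps by move=> Z hZ; exact: F_tan.
have [Y' [hY' h1 h2]] := projected_euler_step r_lt_m r_le_n hG (F_lip tT) L0
  (F_bound (fac_mx Y) tT) hY e0 le_e tau0.
exists Y'; split => //; apply: le_trans h1 _; rewrite ler_wpM2l //.
have b0 : 0 <= b by apply: le_trans b1.
have e1 : 0 <= 2 * n%:R * L * b * e by rewrite !mulr_ge0 // ltW.
have e2 : 0 <= (1 + 2 * n%:R) * tau by rewrite mulr_ge0 // addr_ge0.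
rewrite /cProj; move: e1 e2; lra.
Qed.

(** An approximation of rank at most r to the flow over [t, t + N tau] whose row
   space stays close to that of Y, by N small projected Euler steps.  The error
   of the whole polygon is of first order in tau, so that a small tau leaves only
   the error caused by the normal part of the field. *)
Lemma rank_r_flow e tau t N (Y : factors R m n r) :
  0 <= t -> 0 <= tau -> t + N%:R * tau <= T -> orth_factors Y -> 0 < e -> eps <= e ->
  exists W : nat -> factors R m n r, [/\ W 0%N = Y,
    orth_factors (W N),
    forall j, (j < N)%N -> frob (fac_mx (W j.+1) - fac_mx (W j)
      - tau *: F (t + j%:R * tau) (fac_mx (W j))) <= tau * (cProj * (e + tau)) &
    frob (facV (W N) *m (facV (W N))^T - facV Y *m (facV Y)^T)
      <= 4 * n%:R * L * (N%:R * tau)].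
Proof.
move=> t0 tau0 tN hY e0 le_e.
(* Dependent choice: the step is made total by leaving it arbitrary outside the
   time interval and on non-orthonormal factors. *)
pose P (q : nat * factors R m n r) (Y' : factors R m n r) :=
  t + q.1%:R * tau \in `[0, T] -> orth_factors q.2 -> [/\ orth_factors Y',
    frob (fac_mx Y' - fac_mx q.2 - tau *: F (t + q.1%:R * tau) (fac_mx q.2))
      <= tau * (cProj * (e + tau))
    & frob (facV Y' *m (facV Y')^T - facV q.2 *m (facV q.2)^T) <= 4 * n%:R * L * tau].
have /choice [step hstep] : forall q, exists Y', P q Y'.
  move=> q; rewrite /P.
  have [qT|] := boolP (t + q.1%:R * tau \in `[0, T]); last by exists q.2.
  have [hq|nq] := pselect (orth_factors q.2); last by exists q.2.
  by have [Y' h] := field_euler_step qT hq e0 le_e tau0; exists Y'.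
pose W := fix W j := if j is i.+1 then step (i, W i) else Y.
have inT j : (j <= N)%N -> t + j%:R * tau \in `[0, T].
  move=> jN; rewrite in_itv /=; have : 0 <= j%:R * tau by rewrite mulr_ge0.
  have : j%:R * tau <= N%:R * tau by rewrite ler_wpM2r // ler_nat.
  by move: t0 tN; lra.
have hW j : (j <= N)%N -> orth_factors (W j) /\
    frob (facV (W j) *m (facV (W j))^T - facV Y *m (facV Y)^T) <= 4 * n%:R * L * (j%:R * tau).
  elim: j => [|j IH] jN; first by rewrite /= subrr frob0 mul0r mulr0.
  have [hj dj] := IH (ltnW jN).
  have [h1 _ h3] := hstep (j, W j) (inT j (ltnW jN)) hj.
  split=> //; apply: le_trans (frob_tri (facV (W j) *m (facV (W j))^T) _ _) _.
  have -> : 4 * n%:R * L * (j.+1%:R * tau) = 4 * n%:R * L * tau + 4 * n%:R * L * (j%:R * tau).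
    by rewrite -[j.+1%:R]natr1; ring.
  exact: lerD.
exists W; split=> //; [by case: (hW N (leqnn N))| |by case: (hW N (leqnn N))].
move=> j jN; have [hj _] := hW j (ltnW jN).
by have [_ h2 _] := hstep (j, W j) (inT j (ltnW jN)) hj.
Qed.

Definition cStage : R := 6 * cProj.
Definition cIncr : R := L * cStage.
Definition cStep : R := 3 * (cIncr + cTaylor + expR L * (2 * cProj + 2 * cDefect)).

(** For the increment, only the first stage and the Lipschitz bound matter.
   For the output, the K-L step is compared with the rank-r flow. *)
Lemma midpoint_step_error t h (Y Ymid Ynext : factors R m n r) :
  0 <= t -> t + h <= T -> 0 < h <= 1 -> 4 * n%:R * L * h <= 1 / 2 ->
  orth_factors Y -> midpoint_step F h t Y Ymid Ynext ->
  frob (fac_mx Y + midpoint_incr F h t Ymid -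
     (fac_mx Y + h *: F (t + h / 2) (fac_mx Y + (h / 2) *: F t (fac_mx Y))))
     <= cIncr * (h ^+ 3 + h ^+ 2 * eps) /\
  frob (fac_mx Ynext - (fac_mx Y + midpoint_incr F h t Ymid)) <= cStep * (h ^+ 3 + h * eps).
Proof.
move=> t0 th /andP [h0 h1] hn hY [hmid hnext].
have tT : t \in `[0, T] by rewrite in_itv /=; lra.
have thT : t + h / 2 \in `[0, T] by rewrite in_itv /=; lra.
have h2 : 0 <= h / 2 by lra.
have hV : orthonormal_cols (facV Y) by case: hY.
(* The regularization parameter has to be positive, also when eps = 0; the
   term h^2 contributes h^3 to the error of the step. *)
pose e := eps + h ^+ 2.
have hh : h ^+ 2 <= h by rewrite expr2 ler_piMr // ltW.
have hsq : 0 < h ^+ 2 by rewrite exprn_gt0.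
have e0 : 0 < e by rewrite ltr_wpDl.
have le_e : eps <= e by rewrite lerDl ltW.
have c0 := cProj_ge0.
have Rproj X : orth_factors X -> fac_mx X = fac_mx X *m (facV X *m (facV X)^T) :> 'M[R]_(m, n).
  by case=> _ hX; rewrite {2}/fac_mx mulmxA -(mulmxA _ (facV X)^T) hX mulmx1.
have mid : frob (fac_mx Ymid - (fac_mx Y + (h / 2) *: F t (fac_mx Y))) <= cStage * (h * (eps + h)).
  have [X [hX X1 X2]] := field_euler_step tT hY e0 le_e h2.
  have hX2 : frob (facV X *m (facV X)^T - facV Y *m (facV Y)^T) <= 1 / 2.
    apply: le_trans X2 (le_trans _ hn); rewrite ler_wpM2l ?mulr_ge0 //; lra.
  have := KL_step_quasi_optimal hmid hV (Rproj _ X hX) hX2.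
  rewrite /stage_incr => q; apply: le_trans q _; rewrite frobC opprD addrA.
  have -> : cStage * (h * (eps + h)) = 3 * (h / 2 * (cProj * (4 * (eps + h)))) by rewrite /cStage; field.
  rewrite ler_wpM2l //; apply: le_trans X1 _; rewrite ler_wpM2l // ler_wpM2l // /e.
  by move: eps0; lra.
have incr : frob (fac_mx Y + midpoint_incr F h t Ymid -
     (fac_mx Y + h *: F (t + h / 2) (fac_mx Y + (h / 2) *: F t (fac_mx Y))))
     <= cIncr * (h ^+ 3 + h ^+ 2 * eps).
  rewrite opprD addrACA subrr add0r /midpoint_incr -scalerBr frobZ gtr0_norm //.
  have -> : cIncr * (h ^+ 3 + h ^+ 2 * eps) = h * (L * (cStage * (h * (eps + h)))) by rewrite /cIncr; ring.
  rewrite ler_wpM2l ?(ltW h0) //; apply: le_trans (F_lip thT _ _) _.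
  by rewrite ler_wpM2l.
split=> //.
have [||p [p0 p1 p2]] := @quadratic_approximation t (fac_mx Y); [lra|lra|].
have [N [tau [Nt tau0 tauh]]] := exists_substep h0.
have tN : t + N%:R * tau <= T by rewrite Nt.
have [W [W0 WN W1 W2]] := rank_r_flow t0 tau0 tN hY e0 le_e.
have cp := cDefect_ge0.
have := @perturbed_euler t tau (cProj * (e + tau)) N p (fun j => fac_mx (W j)) t0 tau0.
rewrite Nt W0 p0 => H.
have {H} flow : frob (fac_mx (W N) - p h) <=
    expR L * (h * (cProj * (e + tau) + cDefect * (h ^+ 2 + tau))).
  by apply: H => //; rewrite mulr_ge0 // addr_ge0 // ltW.
have hWN : frob (facV (W N) *m (facV (W N))^T - facV Y *m (facV Y)^T) <= 1 / 2.
  by apply: le_trans W2 _; rewrite Nt.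
apply: le_trans (KL_step_quasi_optimal hnext hV (Rproj _ _ WN) hWN) _.
rewrite /cStep -mulrA ler_wpM2l //.
apply: le_trans (frob_tri _ _ _) _; last apply: le_trans (lerD incr (frob_tri (p h) _ _)) _.
rewrite (frobC (p h)).
apply: le_trans (lerD (lexx _) (lerD (p2 h (ltW h0) th) flow)) _.
rewrite addrA (mulrDl (cIncr + cTaylor)); apply: lerD; last first.
  rewrite -(mulrA (expR L)) ler_wpM2l ?expR_ge0 //.
  have -> : (2 * cProj + 2 * cDefect) * (h ^+ 3 + h * eps) =
    h * (cProj * (eps + h ^+ 2 + h ^+ 2) + cDefect * (h ^+ 2 + h ^+ 2) + (cProj * eps + 2 * (cDefect * eps))).
    by ring.
  rewrite ler_wpM2l ?(ltW h0) // -[leLHS]addr0; apply: lerD.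
    by apply: lerD; rewrite ler_wpM2l // lerD.
  by rewrite addr_ge0 ?mulr_ge0.
have h3 : 0 < h ^+ 3 by rewrite exprn_gt0.
have he : 0 <= h * eps by rewrite mulr_ge0 // ltW.
rewrite (mulrDl cIncr); apply: lerD.
  rewrite ler_wpM2l ?mulr_ge0 // lerD2l ler_wpM2r //.
by rewrite ler_wpM2l ?cTaylor_ge0 // lerDl.
Qed.

Definition cLocal : R := cIncr + cStep + cSolution.

Lemma cIncr_ge0 : 0 <= cIncr.
Proof. by rewrite /cIncr /cStage !mulr_ge0 // cProj_ge0. Qed.

Lemma cSolution_ge0 : 0 <= cSolution.
Proof.
by rewrite addr_ge0 ?cTaylor_ge0 // mulr_ge0 ?expR_ge0 // addr_ge0 ?cEuler_ge0 // mulr_ge0 ?cDefect_ge0.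
Qed.

Lemma cStep_ge0 : 0 <= cStep.
Proof.
rewrite mulr_ge0 // !addr_ge0 ?cIncr_ge0 ?cTaylor_ge0 // mulr_ge0 ?expR_ge0 //.
by rewrite addr_ge0 // mulr_ge0 ?cProj_ge0 ?cDefect_ge0.
Qed.

Hypothesis L1 : 1 <= L.

Lemma step_size_bounds h : 0 < h -> 8 * n.+1%:R * L * h <= 1 ->
  [/\ h <= 1, h * L <= 1 & 4 * n%:R * L * h <= 1 / 2].
Proof.
move=> h0; rewrite -[n.+1%:R]natr1 => hs.
have hL : h <= L * h by rewrite ler_peMl // ltW.
have nLh : 0 <= n%:R * (L * h) by rewrite !mulr_ge0 // ltW.
have e : 8 * (n%:R + 1) * L * h = 8 * (n%:R * (L * h)) + 8 * (L * h) by ring.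
rewrite e in hs; split; [lra|rewrite mulrC; lra|].
by rewrite (_ : _ * h = 4 * (n%:R * (L * h))); [lra|ring].
Qed.

Lemma local_error t h (Y Ymid Ynext : factors R m n r) A0 A :
  0 <= t -> t + h <= T -> 0 < h -> 8 * n.+1%:R * L * h <= 1 ->
  orth_factors Y -> midpoint_step F h t Y Ymid Ynext ->
  ode_solution (fun s => F (t + s)) 0 h A0 A -> A0 = fac_mx Y ->
  frob (fac_mx Y + midpoint_incr F h t Ymid - A h) <= cLocal * (h ^+ 3 + h ^+ 2 * eps) /\
  frob (fac_mx Ynext - A h) <= cLocal * (h ^+ 3 + h * eps).
Proof.
move=> t0 th h0 hs hY hst hA A0E.
have [h1 hL hn] := step_size_bounds h0 hs.
have hh : 0 < h <= 1 by rewrite h0.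
have [e1 e2] := midpoint_step_error t0 th hh hn hY hst.
have := @solution_midpoint_error 0 h A0 A t 0 h hA.
rewrite !addr0 !add0r (proj1 hA) A0E => /(_ t0 th (lexx _) hh (lexx _)) e3.
have i0 := cIncr_ge0; have s0 := cSolution_ge0; have b0 := cStep_ge0.
have h3 : 0 <= h ^+ 3 by rewrite exprn_ge0 // ltW.
have h2e : 0 <= h ^+ 2 * eps by rewrite mulr_ge0 // sqr_ge0.
have he : h ^+ 2 * eps <= h * eps by rewrite ler_wpM2r // expr2 ler_piMr // ltW.
have locE x : cLocal * x = cIncr * x + cStep * x + cSolution * x by rewrite /cLocal; ring.
have le1 (c x y : R) : 0 <= c -> x <= y -> c * x <= c * y by move=> c0; apply: ler_wpM2l.
split.
  apply: le_trans (frob_tri _ _ _) (le_trans (lerD e1 e3) _).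
  have q : cSolution * h ^+ 3 <= cSolution * (h ^+ 3 + h ^+ 2 * eps).
    by apply: le1 => //; lra.
  have q' : 0 <= cStep * (h ^+ 3 + h ^+ 2 * eps) by rewrite mulr_ge0 ?addr_ge0.
  by rewrite locE; move: q q'; lra.
apply: le_trans (frob_tri _ _ _) (le_trans (lerD e2 (frob_tri _ _ _)) _).
apply: le_trans (lerD (lexx _) (lerD e1 e3)) _.
have q : cSolution * h ^+ 3 <= cSolution * (h ^+ 3 + h * eps) by apply: le1 => //; lra.
have q' : cIncr * (h ^+ 3 + h ^+ 2 * eps) <= cIncr * (h ^+ 3 + h * eps).
  by apply: le1 => //; lra.
by rewrite locE; move: q q'; lra.
Qed.

(** The numerical step is compared with the midpoint map at the same iterate, and
   the midpoint map with the exact solution along A only; in between, the error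
   is propagated by the Lipschitz constant of the midpoint map. *)
Lemma global_error t0 h delta A0 A (Y Ymid : nat -> factors R m n r) :
  0 < h -> 8 * n.+1%:R * L * h <= 1 -> 0 <= t0 <= T ->
  ode_solution F t0 T A0 A -> orth_factors (Y 0%N) ->
  frob (fac_mx (Y 0%N) - A t0) <= delta ->
  (forall j : nat, t0 + j.+1%:R * h <= T ->
     midpoint_step F h (t0 + j%:R * h) (Y j) (Ymid j) (Y j.+1)) ->
  forall j : nat, t0 + j%:R * h <= T ->
    frob (fac_mx (Y j) - A (t0 + j%:R * h))
      <= expR (2 * L * T) * (1 + T * cLocal) * (delta + eps + h ^+ 2).
Proof.
move=> h0 hs /andP [t00 t0T] hA hY0 hdelta hstep N tN.
have [h1 hL hn] := step_size_bounds h0 hs.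
have hh : 0 < h <= 1 by rewrite h0.
have i0 := cIncr_ge0; have s0 := cSolution_ge0; have b0 := cStep_ge0.
have loc0 : 0 <= cLocal := addr_ge0 (addr_ge0 i0 b0) s0.
have jle j : (j <= N)%N -> t0 + j%:R * h <= T.
  move=> jN; apply: le_trans tN; rewrite lerD2l ler_wpM2r ?ler_nat //; exact: ltW.
have hY j : (j <= N)%N -> orth_factors (Y j).
  case: j => [//|j] jN; have [_ [hU _ hV _]] := hstep j (jle _ jN); exact: conj.
have hA' : ode_solution (fun s => F (0 + s)) t0 T A0 A.
  by rewrite (_ : (fun s => F (0 + s)) = F) //; apply/funext => s; rewrite add0r.
pose e j := frob (fac_mx (Y j) - A (t0 + j%:R * h)).
pose c := cLocal * (h * (eps + h ^+ 2)).
have hs0 : 0 <= h ^+ 2 by exact: sqr_ge0.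
have c0 : 0 <= c.
  by apply: mulr_ge0 => //; apply: mulr_ge0; [exact: ltW|exact: addr_ge0].
have a0 : 0 <= 2 * L * h by rewrite !mulr_ge0 // ltW.
have := @discrete_gronwall R e (2 * L * h) c N a0 c0 (frob_ge0 _) => H.
have {H} bound : e N <= expR (2 * L * h * N%:R) * (e 0%N + N%:R * c).
  apply: H => j jN; rewrite /e; set t := t0 + j%:R * h.
  have jh : 0 <= j%:R * h by rewrite mulr_ge0 // ltW.
  have tE : t0 + j.+1%:R * h = t + h by rewrite -[j.+1%:R]natr1 /t; ring.
  have tp : 0 <= t by rewrite addr_ge0.
  have th : t + h <= T by rewrite -tE jle.
  have st : midpoint_step F h t (Y j) (Ymid j) (Y j.+1) by apply: hstep; rewrite tE.
  have [e1 e2] := midpoint_step_error tp th hh hn (hY j (ltnW jN)) st.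
  have := @solution_midpoint_error t0 T A0 A 0 t h hA'.
  rewrite !add0r => /(_ t00 (lexx _)) e3.
  have {}e3 := e3 (ltac:(by rewrite /t lerDl)) hh th.
  have e4 := midpoint_map_lip (fac_mx (Y j)) (A t) tp (ltW h0) th hL.
  rewrite tE; move: e1 e2 e3 e4.
  set y1 := fac_mx (Y j.+1); set y2 := _ + midpoint_incr _ _ _ _.
  set y3 := _ + h *: F (t + h / 2) (fac_mx (Y j) + _); set y4 := A t + h *: _.
  move=> e1 e2 e3 e4.
  apply: le_trans (frob_tri y2 _ _) _.
  apply: le_trans (lerD e2 (frob_tri y3 _ _)) _.
  apply: le_trans (lerD (lexx _) (lerD e1 (frob_tri y4 _ _))) _.
  apply: le_trans (lerD (lexx _) (lerD (lexx _) (lerD e4 e3))) _.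
  have he : h ^+ 2 * eps <= h * eps by rewrite ler_wpM2r // expr2 ler_piMr // ltW.
  have h2e : 0 <= h * eps by rewrite mulr_ge0 // ltW.
  have q1 : cIncr * (h ^+ 3 + h ^+ 2 * eps) <= cIncr * (h ^+ 3 + h * eps).
    by rewrite ler_wpM2l // lerD2l.
  have q2 : cSolution * h ^+ 3 <= cSolution * (h ^+ 3 + h * eps).
    by rewrite ler_wpM2l // lerDl.
  have -> : c = cIncr * (h ^+ 3 + h * eps) + cStep * (h ^+ 3 + h * eps)
      + cSolution * (h ^+ 3 + h * eps) by rewrite /c /cLocal; ring.
  by move: q1 q2; lra.
have Nh : N%:R * h <= T by move: tN t00; lra.
have Nh0 : 0 <= N%:R * h by rewrite mulr_ge0 // ltW.
have T0 : 0 <= T by apply: le_trans t0T.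
have d0 : 0 <= delta by apply: le_trans hdelta; exact: frob_ge0.
apply: le_trans bound _; rewrite -(mulrA (expR (2 * L * T))).
apply: ler_pM; rewrite ?expR_ge0 //.
- by rewrite addr_ge0 ?frob_ge0 // mulr_ge0.
- rewrite ler_expR (_ : 2 * L * h * N%:R = 2 * L * (N%:R * h)); last by ring.
  by rewrite ler_wpM2l // mulr_ge0.
have ee : e 0%N <= delta by rewrite /e mul0r addr0.
have q1 : N%:R * c <= T * cLocal * (eps + h ^+ 2).
  rewrite /c (_ : N%:R * _ = N%:R * h * (cLocal * (eps + h ^+ 2))); last by ring.
  by rewrite -(mulrA T) ler_wpM2r // mulr_ge0 // addr_ge0.
have q2 : 0 <= T * cLocal * delta by rewrite !mulr_ge0.
have -> : (1 + T * cLocal) * (delta + eps + h ^+ 2) = delta + T * cLocal * (eps + h ^+ 2)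
   + (eps + h ^+ 2 + T * cLocal * delta) by ring.
by apply: le_trans (lerD ee q1) _; rewrite lerDl !addr_ge0.
Qed.

End Step.
End Euler.


Theorem mainTheorem7 (R : realType) (m n r : nat) (B LF M : R) :
  (1 <= r)%N -> (r < minn m n)%N ->
  exists (h0 C : R) (CT : R -> R), 0 < h0 /\
  forall (T eps : R) (F : R -> 'M[R]_(m, n) -> 'M[R]_(m, n)),
  0 < T -> 0 <= eps ->
  {within `[0, T] `*` [set: 'M[R]_(m, n)],
    continuous (fun p : R * 'M[R]_(m, n) => F p.1 p.2)} ->
  (forall t X, t \in `[0, T] -> frob (F t X) <= B) ->
  (forall t X Z, t \in `[0, T] ->
    frob (F t X - F t Z) <= LF * frob (X - Z)) ->
  tangent_bound r T F eps ->
  class_C 2 T F ->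
  (forall (a b : nat) t X, (1 <= a + b <= 2)%N -> t \in `[0, T] ->
    (multilin_norm (@mixed_partial R m n T F a b t X) <= M%:E)%E) ->
  forall h : R, 0 < h <= h0 ->
  (* (i) local error *)
  (forall (tn : R) (Yn Ymid Ynext : factors R m n r) (An : R -> 'M[R]_(m, n)),
    0 <= tn <= T - h ->
    rank_r_factors Yn ->
    midpoint_step F h tn Yn Ymid Ynext ->
    midpoint_admissible F h tn Yn Ymid ->
    ode_solution (fun s => F (tn + s)) 0 h (fac_mx Yn) An ->
    frob (fac_mx Yn + midpoint_incr F h tn Ymid - An h)
      <= C * (h ^+ 3 + h ^+ 2 * eps) /\
    frob (fac_mx Ynext - An h) <= C * (h ^+ 3 + h * eps)) /\
  (* (ii) global error *)
  (forall (t0 delta : R) (A0 : 'M[R]_(m, n)) (A : R -> 'M[R]_(m, n))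
      (Y Ymid : nat -> factors R m n r),
    0 <= t0 <= T ->
    ode_solution F t0 T A0 A ->
    rank_r_factors (Y 0%N) ->
    frob (fac_mx (Y 0%N) - A t0) <= delta ->
    (forall k : nat, t0 + k.+1%:R * h <= T ->
      midpoint_step F h (t0 + k%:R * h) (Y k) (Ymid k) (Y k.+1) /\
      midpoint_admissible F h (t0 + k%:R * h) (Y k) (Ymid k)) ->
    forall k : nat, t0 + k%:R * h <= T ->
      frob (fac_mx (Y k) - A (t0 + k%:R * h))
        <= CT T * (delta + eps + h ^+ 2)).
Proof.
move=> _ rmn.
have rm : (r < m)%N by apply: leq_trans rmn (geq_minl m n).
have rn : (r <= n)%N by apply: ltnW; apply: leq_trans rmn (geq_minr m n).
pose b := `|B| + 1; pose L := `|LF| + 1; pose M' := `|M|.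
have M0 : 0 <= M' := normr_ge0 M.
have L1 : 1 <= L by rewrite lerDr.
have L0 : 0 <= L by apply: le_trans L1.
have b1 : 1 <= b by rewrite lerDr.
pose k := 8 * n.+1%:R * L; have k0 : 0 < k by rewrite !mulr_gt0 // (lt_le_trans _ L1).
exists k^-1, (cLocal m n M' L b), (fun T => expR (2 * L * T) * (1 + T * cLocal m n M' L b)).
split=> [|T eps F T0 eps0 _ FB FL F_tan F_C2 FD h /andP [h0 hk]]; first by rewrite invr_gt0.
have hs : k * h <= 1 by rewrite mulrC -ler_pdivlMr // mul1r.
have F_bound t X : t \in `[0, T] -> frob (F t X) <= b.
  by move=> tT; apply: le_trans (FB t X tT) _; rewrite /b ler_wpDr // ler_norm.
have F_lip t : t \in `[0, T] -> lipschitz_frob (F t) L.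
  move=> tT X Z; apply: le_trans (FL t X Z tT) _; rewrite ler_wpM2r ?frob_ge0 //.
  by rewrite /L ler_wpDr // ler_norm.
have F_der (a c : nat) t X : (1 <= a + c <= 2)%N -> t \in `[0, T] ->
    (multilin_norm (@mixed_partial R m n T F a c t X) <= M'%:E)%E.
  by move=> ac tT; apply: le_trans (FD a c t X ac tT) _; rewrite lee_fin ler_norm.
split.
  move=> tn Yn Ymid Ynext An /andP [tn0 tnh] [hU hV _] hst _ hA.
  apply: (local_error M0 L0 b1 F_bound F_lip F_C2 F_der rm rn eps0 F_tan L1) hA _ => //.
  by rewrite -lerBrDr.
move=> t0 delta A0 A Y Ymid t0T hA [hU hV _] hd hst.
exact: (global_error M0 L0 b1 F_bound F_lip F_C2 F_der rm rn eps0 F_tan L1 h0 hs t0T hA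
  (conj hU hV) hd (fun j hj => proj1 (hst j hj))).
Qed.
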